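(* Let $n\ge 1$ and let $(\varphi_t)_{t\ge 0}$ be a continuous semigroup of holomorphic self-maps of the unit ball $\mathbb{B}^n\subset\mathbb{C}^n$. Then $(\varphi_t)$ is a semigroup of linear fractional maps (i.e. every $\varphi_t$, $t\geq 0$, is a linear fractional self-map of $\mathbb{B}^n$) if and only if there exist $a,b\in\mathbb{C}^n$ and $A\in\mathbb{C}^{n\times n}$ (not all of them zero) such that the infinitesimal generator of $(\varphi_t)$ is $$G(z)=a-\langle z,a\rangle z-[Az+\langle z,b\rangle z],\qquad z\in\mathbb{B}^n,$$ with $$|\langle b,u\rangle|\le \mathrm{Re}\,\langle Au,u\rangle\quad\text{for all }u\in\partial\mathbb{B}^n.$$
   Context: $\mathbb{B}^n=\{z\in\mathbb{C}^n:\|z\|<1\}$, and $\langle z,w\rangle=\sum_j z_j\overline{w_j}$ is the standard Hermitian product on $\mathbb{C}^n$. A (continuous) semigroup of holomorphic self-maps of $\mathbb{B}^n$ is a family $(\varphi_t)_{t\ge0}$ of holomorphic maps $\varphi_t:\mathbb{B}^n\to\mathbb{B}^n$ with $\varphi_0=\mathrm{id}$, $\varphi_{t+s}=\varphi_t\circ\varphi_s$ for all $s,t\ge0$, and $\varphi_t\to\mathrm{id}$ uniformly on compacta as $t\to0^+$. Its infinitesimal generator is the holomorphic map $G:\mathbb{B}^n\to\mathbb{C}^n$ with $\frac{\partial\varphi_t}{\partial t}=G\circ\varphi_t$ for all $t\ge0$. A linear fractional map on $\mathbb{B}^n$ is a map $\varphi(z)=\dfrac{Mz+B}{\langle z,C\rangle+D}$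 with $M\in\mathbb{C}^{n\times n}$, $B,C\in\mathbb{C}^n$ (column vectors), $D\in\mathbb{C}$, $|D|>\|C\|$ and $DM\ne BC^*$; it is a linear fractional self-map if $\varphi(\mathbb{B}^n)\subset\mathbb{B}^n$.
   Formalization: The requirement that a, b, A are not all zero is imposed only when the semigroup is not the identity semigroup; for φ_t = id, which is linear fractional with generator 0, the stated form forces a = b = A = 0, so the literal equivalence fails. *)

(* Defs.v *)
From HB Require Import structures.
From mathcomp Require Import all_boot all_order all_algebra.
From mathcomp Require Import complex.
From mathcomp Require Import all_classical all_reals all_analysis.
Set Implicit Arguments.
Unset Strict Implicit.
Unset Printing Implicit Defensive.
Import Order.TTheory GRing.Theory Num.Theory.
Import numFieldNormedType.Exports.
Local Open Scope classical_set_scope.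
Local Open Scope ring_scope.

(* [R[i]] is packed as a [numClosedFieldType] so that it and ['cV_n] over it
   inherit the normed-module structures over a [numFieldType]; in particular
   [differentiable] is then complex (Frechet) differentiability.  The order on
   [Cplx R] is the partial one: [x <= y] means that [y - x] is a nonnegative
   real, and norms and real parts take values in [Cplx R]. *)
Definition Cplx (R : realType) : numClosedFieldType := R[i].

Definition cdot (R : realType) (n : nat) (z w : 'cV[Cplx R]_n) : Cplx R :=
  \sum_(j < n) z j ord0 * (w j ord0)^*.

(* Euclidean; the norm [`|z|] of the library on matrices is the sup norm. *)
Definition enorm (R : realType) (n : nat) (z : 'cV[Cplx R]_n) : Cplx R :=
  sqrtC (cdot z z).

Definition cball (R : realType) (n : nat) : set 'cV[Cplx R]_n :=
  [set z | enorm z < 1].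

Definition csphere (R : realType) (n : nat) : set 'cV[Cplx R]_n :=
  [set u | enorm u = 1].

Arguments cball : clear implicits.
Arguments csphere : clear implicits.

(* Maps on the ball are total functions on C^n whose values off the (open) ball
   are irrelevant. *)
Definition holomorphic_on_ball (R : realType) (n : nat)
    (f : 'cV[Cplx R]_n -> 'cV[Cplx R]_n) : Prop :=
  forall z, cball R n z -> differentiable f z.

Definition ball_selfmap (R : realType) (n : nat)
    (f : 'cV[Cplx R]_n -> 'cV[Cplx R]_n) : Prop :=
  forall z, cball R n z -> cball R n (f z).

Record continuous_semigroup (R : realType) (n : nat)
    (phi : R -> 'cV[Cplx R]_n -> 'cV[Cplx R]_n) : Prop := {
  semigroup_holomorphic : forall t, 0 <= t -> holomorphic_on_ball (phi t);
  semigroup_selfmap : forall t, 0 <= t -> ball_selfmap (phi t);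
  semigroup0 : forall z, cball R n z -> phi 0 z = z;
  semigroupD : forall s t z, 0 <= s -> 0 <= t -> cball R n z ->
    phi (t + s) z = phi t (phi s z);
  semigroup_continuous : forall K : set 'cV[Cplx R]_n,
    compact K -> K `<=` cball R n -> {uniform K, phi t @[t --> 0^'+] --> id}
}.

(* The time derivative is two-sided for [0 < t] and one-sided at [t = 0]. *)
Definition infinitesimal_generator (R : realType) (n : nat)
    (phi : R -> 'cV[Cplx R]_n -> 'cV[Cplx R]_n)
    (G : 'cV[Cplx R]_n -> 'cV[Cplx R]_n) : Prop :=
  holomorphic_on_ball G /\
  forall (t : R) (z : 'cV[Cplx R]_n), 0 <= t -> cball R n z ->
    ((h%:C)%C : Cplx R)^-1 *: (phi (t + h) z - phi t z)
      @[h --> within [set h : R | 0 <= t + h] 0^'] --> G (phi t z).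

Definition linear_fractional (R : realType) (n : nat)
    (f : 'cV[Cplx R]_n -> 'cV[Cplx R]_n) : Prop :=
  exists (M : 'M[Cplx R]_n) (B C : 'cV[Cplx R]_n) (D : Cplx R),
    [/\ enorm C < `|D|,
        D *: M <> B *m (map_mx Num.conj C)^T &
        forall z, cball R n z -> f z = (cdot z C + D)^-1 *: (M *m z + B)].

Definition linear_fractional_selfmap (R : realType) (n : nat)
    (f : 'cV[Cplx R]_n -> 'cV[Cplx R]_n) : Prop :=
  linear_fractional f /\ ball_selfmap f.

Definition trivial_semigroup (R : realType) (n : nat)
    (phi : R -> 'cV[Cplx R]_n -> 'cV[Cplx R]_n) : Prop :=
  forall t z, 0 <= t -> cball R n z -> phi t z = z.

(* Main.v *)
Require Import Defs.
From mathcomp Require Import all_boot all_order all_algebra.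
From mathcomp Require Import complex ring lra.
From mathcomp Require Import all_classical all_reals all_analysis.
Set Implicit Arguments.
Unset Strict Implicit.
Unset Printing Implicit Defensive.
Import Order.TTheory GRing.Theory Num.Theory.
Import numFieldNormedType.Exports.
Local Open Scope classical_set_scope.
Local Open Scope ring_scope.

(** In homogeneous coordinates (w, s), with z = w / s, linear fractional maps of
    C^n are linear maps of C^(n+1), and the vector field
    G(z) = a - <z,a> z - (A z + <z,b> z) is the projection of the linear system
    w' = - A w + s a,  s' = <w, a + b>,  that is Y' = L Y.

    From the generator to the maps.  Let (w, s) be the solution of Y' = L Y that
    starts at (z, 1).  The difference y = w - s phi_t(z) satisfies a homogeneous
    linear system with bounded coefficients and y(0) = 0, so y = 0 by Gronwall:
    phi_t is the quotient w / s given by the blocks M, B, C^*, D of exp(tL)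
    (lemma linearized_flow).  Gronwall run backwards shows that exp(tL) is
    injective.  Hence s does not vanish on the ball, D M differs from B C^*, and
    |C| < |D|: otherwise s would vanish at a point u of the closed ball, and w
    would vanish at u too because |w| <= |s| inside the ball.

    From the maps to the generator.  Normalise phi_t so that D = 1, and let X_t,
    B_t, c_t be the entries of M - 1, B and C^*.  They are rational functions of
    the displacements phi_t(p) - p at finitely many test points p, and conversely
    the displacement function of phi_t is Lipschitz with a constant that is linear
    in the size V(t) of these test displacements.  With the semigroup law, the
    vector x(t) of test displacements is almost additive:
    |x(s + t) - x(s) - x(t)| <= K V(s) V(t), while V(t) tends to 0 with t.  An
    elementary argument on multiples of a small time then shows that x(t) / t
    converges (lemma almost_additive_derivable).  So the coefficients have a
    derivative at t = 0, and the semigroup law propagates it to the derivative of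
    phi_t(z) at every time (lemma flow_derivative), with a generator of the required
    form.

    The inequality.  By continuity |u + X_t u + B_t| <= |1 + c_t u| for every unit
    vector u, with equality at t = 0.  Dividing by t gives
    Re <Au,u> + Re <u,b> >= 0 (lemma boundary_inequality), and replacing u by its
    multiples of modulus one turns Re <u,b> into - |<b,u>|. *)

(** * Real and imaginary parts *)

Section ComplexParts.
Variable R : realType.
Local Notation C := (Cplx R).
Local Notation rp := (@complex.Re R).
Local Notation ip := (@complex.Im R).
Implicit Types (x y z : C) (k : R).

Definition rc k : C := (k%:C)%C.

Lemma rpD x y : rp (x + y) = rp x + rp y. Proof. by case: x y => [? ?] []. Qed.
Lemma ipD x y : ip (x + y) = ip x + ip y. Proof. by case: x y => [? ?] []. Qed.
Lemma rpN x : rp (- x) = - rp x. Proof. by case: x. Qed.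
Lemma ipN x : ip (- x) = - ip x. Proof. by case: x. Qed.
Lemma rpB x y : rp (x - y) = rp x - rp y. Proof. by rewrite rpD rpN. Qed.
Lemma ipB x y : ip (x - y) = ip x - ip y. Proof. by rewrite ipD ipN. Qed.
Lemma rpM x y : rp (x * y) = rp x * rp y - ip x * ip y.
Proof. by case: x y => [? ?] []. Qed.
Lemma ipM x y : ip (x * y) = rp x * ip y + ip x * rp y.
Proof. by case: x y => [? ?] []. Qed.
Lemma rp_conj x : rp x^* = rp x. Proof. by case: x. Qed.
Lemma ip_conj x : ip x^* = - ip x. Proof. by case: x. Qed.
Lemma rp0 : rp (0 : C) = 0. Proof. by []. Qed.
Lemma ip0 : ip (0 : C) = 0. Proof. by []. Qed.
Lemma rp1 : rp (1 : C) = 1. Proof. by []. Qed.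
Lemma ip1 : ip (1 : C) = 0. Proof. by []. Qed.
Lemma cplx_eq x y : rp x = rp y -> ip x = ip y -> x = y.
Proof. by case: x y => [? ?] [? ?] /= -> ->. Qed.

Lemma rp_sum (I : finType) (F : I -> C) : rp (\sum_i F i) = \sum_i rp (F i).
Proof. exact: (big_morph rp rpD rp0). Qed.
Lemma ip_sum (I : finType) (F : I -> C) : ip (\sum_i F i) = \sum_i ip (F i).
Proof. exact: (big_morph ip ipD ip0). Qed.

Lemma rcD k l : rc (k + l) = rc k + rc l. Proof. exact: rmorphD. Qed.
Lemma rcN k : rc (- k) = - rc k. Proof. exact: rmorphN. Qed.
Lemma rcM k l : rc (k * l) = rc k * rc l. Proof. exact: rmorphM. Qed.
Lemma rcV k : rc (k^-1) = (rc k)^-1. Proof. exact: fmorphV. Qed.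
Lemma rc0 : rc 0 = 0. Proof. by []. Qed.
Lemma rc1 : rc 1 = 1. Proof. by []. Qed.
Lemma rcI k l : rc k = rc l -> k = l. Proof. by case. Qed.
Lemma rc_nat n : rc n%:R = n%:R. Proof. exact: rmorph_nat. Qed.
Lemma rc_eq0 k : (rc k == 0) = (k == 0). Proof. exact: fmorph_eq0. Qed.
Lemma rc_le k l : (rc k <= rc l) = (k <= l). Proof. exact: lecR. Qed.
Lemma rc_lt k l : (rc k < rc l) = (k < l). Proof. exact: ltcR. Qed.
Lemma rp_rc k : rp (rc k) = k. Proof. by []. Qed.

Lemma rp_rcM k x : rp (rc k * x) = k * rp x.
Proof. by rewrite rpM /= mul0r subr0. Qed.
Lemma ip_rcM k x : ip (rc k * x) = k * ip x.
Proof. by rewrite ipM /= mul0r addr0. Qed.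

(** The modulus as an element of [R], where the order is total and linear
    arithmetic applies. *)
Definition nrm x : R := rp `|x|.

Lemma nrmE x : `|x| = rc (nrm x).
Proof. by rewrite /rc /nrm RRe_real // normr_real. Qed.

Lemma norm_rc k : `|rc k| = rc `|k|.
Proof.
have [k0|k0] := leP 0 k.
  by rewrite ger0_norm ?(ger0_norm k0) // -rc0 rc_le.
by rewrite ltr0_norm ?(ltr0_norm k0) ?rcN // -rc0 rc_lt.
Qed.

Lemma nrm_ge0 x : 0 <= nrm x. Proof. by rewrite -rc_le -nrmE rc0. Qed.

Lemma nrmM x y : nrm (x * y) = nrm x * nrm y.
Proof. by rewrite /nrm normrM !nrmE rpM /= mul0r subr0. Qed.
Lemma nrmN x : nrm (- x) = nrm x. Proof. by rewrite /nrm normrN. Qed.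
Lemma nrm0 : nrm 0 = 0. Proof. by rewrite /nrm normr0. Qed.
Lemma nrm1 : nrm 1 = 1. Proof. by rewrite /nrm normr1. Qed.
Lemma nrm_rc k : nrm (rc k) = `|k|. Proof. by rewrite /nrm norm_rc. Qed.
Lemma nrmD x y : nrm (x + y) <= nrm x + nrm y.
Proof. by rewrite -rc_le rcD -!nrmE ler_normD. Qed.
Lemma nrmB x y : nrm (x - y) <= nrm x + nrm y.
Proof. by rewrite (le_trans (nrmD _ _)) // nrmN. Qed.
Lemma nrmV x : nrm x^-1 = (nrm x)^-1.
Proof. by apply: rcI; rewrite -nrmE normfV nrmE -rcV. Qed.
Lemma nrm_eq0 x : (nrm x == 0) = (x == 0).
Proof. by rewrite -rc_eq0 -nrmE normr_eq0. Qed.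
Lemma nrm_sum (I : finType) (F : I -> C) : nrm (\sum_i F i) <= \sum_i nrm (F i).
Proof.
elim/big_ind2 : _ => //=; first by rewrite nrm0.
by move=> a b c d ab cd; rewrite (le_trans (nrmD _ _)) // lerD.
Qed.

Definition sqn x : R := rp x ^+ 2 + ip x ^+ 2.

Lemma sqnE x : sqn x = nrm x ^+ 2.
Proof.
by apply: rcI; rewrite /rc add_Re2_Im2 expr2 nrmE -rcM -expr2.
Qed.

Lemma rp_le_nrm x : `|rp x| <= nrm x.
Proof.
rewrite -(@ler_pXn2r _ 2) ?nnegrE ?nrm_ge0 // -sqnE real_normK ?num_real //.
by rewrite lerDl sqr_ge0.
Qed.
Lemma ip_le_nrm x : `|ip x| <= nrm x.
Proof.
rewrite -(@ler_pXn2r _ 2) ?nnegrE ?nrm_ge0 // -sqnE real_normK ?num_real //.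
by rewrite lerDr sqr_ge0.
Qed.
Lemma nrm_le_parts x : nrm x <= `|rp x| + `|ip x|.
Proof.
rewrite -(@ler_pXn2r _ 2) ?nnegrE ?nrm_ge0 ?addr_ge0 // -sqnE /sqn sqrrD.
rewrite !real_normK ?num_real // addrAC lerDl.
by rewrite mulrn_wge0 // mulr_ge0.
Qed.

Lemma Re_rp x : 'Re x = rc (rp x). Proof. by rewrite -complexRe. Qed.

Lemma cvg_rp {T : Type} {F : set_system T} {FF : Filter F} (f : T -> C) (l : C) :
  f t @[t --> F] --> l -> rp (f t) @[t --> F] --> rp l.
Proof.
move=> /cvgrPdist_lt fl; apply/cvgrPdist_lt => e e0.
have : 0 < rc e by rewrite -rc0 rc_lt.
move=> /fl; apply: filterS => t; rewrite nrmE rc_lt -rpB; apply: le_lt_trans.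
exact: rp_le_nrm.
Qed.

Lemma cvg_ip {T : Type} {F : set_system T} {FF : Filter F} (f : T -> C) (l : C) :
  f t @[t --> F] --> l -> ip (f t) @[t --> F] --> ip l.
Proof.
move=> /cvgrPdist_lt fl; apply/cvgrPdist_lt => e e0.
have : 0 < rc e by rewrite -rc0 rc_lt.
move=> /fl; apply: filterS => t; rewrite nrmE rc_lt -ipB; apply: le_lt_trans.
exact: ip_le_nrm.
Qed.

Lemma gt0_rcP (e : C) : 0 < e -> exists2 k, 0 < k & e = rc k.
Proof.
by rewrite ltcE /= => /andP[/eqP ie re]; exists (rp e) => //; apply: cplx_eq.
Qed.

Lemma cvg_parts {T : Type} {F : set_system T} {FF : Filter F} (f : T -> C) (l : C) :
  rp (f t) @[t --> F] --> rp l -> ip (f t) @[t --> F] --> ip l ->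
  f t @[t --> F] --> l.
Proof.
move=> /cvgrPdist_lt rl /cvgrPdist_lt il; apply/cvgrPdist_lt => _ /gt0_rcP[e e0 ->].
have e20 : 0 < e / 2 by rewrite divr_gt0.
near=> t; rewrite nrmE rc_lt (le_lt_trans (nrm_le_parts _)) // rpB ipB.
by rewrite (splitr e) ltrD //; near: t; [exact: rl | exact: il].
Unshelve. all: by end_near. Qed.

Lemma cvg_nrm0 {T : Type} {F : set_system T} {FF : Filter F} (f : T -> C)
    (g : T -> R) (l : C) :
  (\forall t \near F, nrm (f t - l) <= g t) -> g t @[t --> F] --> 0 ->
  f t @[t --> F] --> l.
Proof.
move=> fg /cvgrPdist_lt g0; apply/cvgrPdist_lt => _ /gt0_rcP[e e0 ->].
near=> t; rewrite distrC nrmE rc_lt.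
have gt : `|0 - g t| < e by near: t; exact: g0.
rewrite sub0r normrN in gt; apply: le_lt_trans gt.
by rewrite (le_trans _ (ler_norm _)) //; near: t.
Unshelve. all: by end_near. Qed.

Section ComplexLimits.
Context {T : Type} {F : set_system T} {FF : Filter F}.
Implicit Types (f g : T -> C) (a b : C).

Lemma ccvgD f g a b : f t @[t --> F] --> a -> g t @[t --> F] --> b ->
  f t + g t @[t --> F] --> a + b.
Proof. exact: cvgD. Qed.

Lemma ccvgB f g a b : f t @[t --> F] --> a -> g t @[t --> F] --> b ->
  f t - g t @[t --> F] --> a - b.
Proof. exact: cvgB. Qed.

Lemma ccvgM f g a b : f t @[t --> F] --> a -> g t @[t --> F] --> b ->
  f t * g t @[t --> F] --> a * b.
Proof. exact: cvgM. Qed.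

Lemma ccvgV f a : a != 0 -> f t @[t --> F] --> a -> (f t)^-1 @[t --> F] --> a^-1.
Proof. by move=> a0 fa; apply: cvgV. Qed.

End ComplexLimits.

End ComplexParts.

Lemma cvg_sumr (K : numFieldType) (V : normedModType K) (T : Type)
    (F : set_system T) (FF : Filter F) (I : finType) (f : I -> T -> V) (l : I -> V) :
  (forall i, f i t @[t --> F] --> l i) ->
  \sum_i f i t @[t --> F] --> \sum_i l i.
Proof.
move=> fl; elim: index_enum => [|i r IH].
  by rewrite big_nil; under eq_fun do rewrite big_nil; exact: cvg_cst.
by rewrite big_cons; under eq_fun do rewrite big_cons; exact: cvgD.
Qed.

(** * Almost additive families of functions *)

Lemma almost_multiple (R : realType) (x : R -> R) (h e : R) (N : nat) :
  x 0 = 0 ->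
  (forall i, (i < N)%N -> `|x (i%:R * h + h) - x (i%:R * h) - x h| <= e) ->
  `|x (N%:R * h) - N%:R * x h| <= N%:R * e.
Proof.
move=> x0; elim: N => [|N IH] H; first by rewrite !mul0r x0 subr0 normr0.
have := IH (fun i iN => H i (ltnW iN)); have := H N (leqnn _).
rewrite -natr1 !mulrDl !mul1r => h1 h2.
rewrite (_ : _ - _ = (x (N%:R * h + h) - x (N%:R * h) - x h)
                     + (x (N%:R * h) - N%:R * x h)); last by ring.
by rewrite (le_trans (ler_normD _ _)) // addrC lerD.
Qed.

Section AlmostAdditive.
Variables (R : realType) (I : finType) (x : I -> R -> R) (K delta : R).
Let V (t : R) : R := \sum_k `|x k t|.
Hypotheses (delta_gt0 : 0 < delta) (K_ge0 : 0 <= K).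
Hypothesis x_add : forall (k : I) (s t : R), 0 <= s -> 0 <= t -> s + t < delta ->
  `|x k (s + t) - x k s - x k t| <= K * V s * V t.
Hypothesis V_cvg0 : forall e : R, 0 < e ->
  exists2 eta : R, 0 < eta & forall t : R, 0 <= t < eta -> V t <= e.

Let V_ge0 t : 0 <= V t. Proof. exact: sumr_ge0. Qed.

Let x_le_V k t : `|x k t| <= V t.
Proof. by rewrite /V (bigD1 k) //= lerDl sumr_ge0. Qed.

Let x_at0 k : x k 0 = 0.
Proof.
apply/eqP; rewrite -normr_le0; apply/ler_addgt0Pl => e /V_cvg0[eta eta0 Ve].
by rewrite addr0 (le_trans (x_le_V k 0)) // Ve // lexx.
Qed.

(** If N t is comparable with a fixed time eta, then x(N t) differs from N x(t), in
    the sum of the components, by at most half of N V(t); as V(N t) is bounded, V(t) is at most of order 1/N, hence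
    of order t. *)
Lemma almost_additive_linear_bound :
  exists C eta, [/\ 0 <= C, 0 < eta, eta <= delta &
    forall t, 0 <= t < eta -> V t <= C * t].
Proof.
(* The factor #|I| compensates for the sum over k in V, so that the N errors add up
   to at most N V(t) / 2. *)
pose K' := K * #|I|%:R + 1.
have K'0 : 0 < K' by rewrite ltr_pwDr // mulr_ge0 // ler0n.
have [eta0 eta00 Veta0] := @V_cvg0 (2 * K')^-1 ltac:(by rewrite invr_gt0 mulr_gt0).
pose eta := Num.min eta0 delta.
have eta_gt0 : 0 < eta by rewrite lt_min eta00.
have etal : eta <= eta0 by rewrite ge_min lexx.
have etar : eta <= delta by rewrite ge_min lexx orbT.
exists (4 / (K' * eta)), (eta / 2); split.
- by rewrite divr_ge0 // mulr_ge0 // ltW.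
- by rewrite divr_gt0.
- by lra.
move=> t /andP[]; rewrite le_eqVlt => /predU1P[<- _|t0 tb].
  by rewrite mulr0 /V big1 // => k _; rewrite x_at0 normr0.
pose N := Num.trunc (eta / (2 * t)).
have tt0 : 0 < 2 * t by lra.
have N1 : N%:R * t <= eta / 2.
  have : N%:R <= eta / (2 * t).
    by rewrite /N; have /andP[] := truncn_itv (ltW (divr_gt0 eta_gt0 tt0)).
  by rewrite ler_pdivlMr //; nra.
have N2 : eta / 2 < N.+1%:R * t.
  have : eta / (2 * t) < N.+1%:R by exact: truncnS_gt.
  by rewrite ltr_pdivrMr //; nra.
have N3 : (1 <= N)%N.
  by rewrite truncn_gt0 ler_pdivlMr //; lra.
have N3' : 1 <= N%:R :> R by rewrite ler1n.
have H k : `|x k (N%:R * t) - N%:R * x k t| <= N%:R * (K * (2 * K')^-1 * V t).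
  apply: almost_multiple => // i iN.
  have it : i%:R * t + t <= N%:R * t.
    by rewrite -[X in _ + X]mul1r -mulrDl ler_wpM2r ?(ltW t0) // natr1 ler_nat.
  have i0 : 0 <= i%:R * t by rewrite mulr_ge0 ?ler0n // ltW.
  apply: (le_trans (x_add _ i0 (ltW t0) _)); first by lra.
  rewrite ler_wpM2r // ler_wpM2l //; apply: Veta0.
  by apply/andP; split => //; lra.
have HS : N%:R * V t <= V (N%:R * t) + #|I|%:R * (N%:R * (K * (2 * K')^-1 * V t)).
  rewrite mulr_sumr -sum1_card natr_sum mulr_suml -big_split /=.
  apply: ler_sum => k _; rewrite mul1r.
  have -> : N%:R * `|x k t| = `|N%:R * x k t| by rewrite normrM ger0_norm.
  have := H k; have := ler_distD (x k (N%:R * t)) (N%:R * x k t) 0.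
  rewrite !subr0 distrC; lra.
have HV : V (N%:R * t) <= (2 * K')^-1.
  apply: Veta0; apply/andP; split; last by lra.
  by rewrite mulr_ge0 ?ler0n // ltW.
have HK : #|I|%:R * (N%:R * (K * (2 * K')^-1 * V t)) <= N%:R * V t / 2.
  have -> : #|I|%:R * (N%:R * (K * (2 * K')^-1 * V t))
            = (N%:R * V t / 2) * ((K * #|I|%:R) / K') by field; lra.
  rewrite ler_piMr ?divr_ge0 ?mulr_ge0 ?ler0n // ler_pdivrMr // mul1r.
  by rewrite /K' lerDl.
have HF : N%:R * V t <= K'^-1.
  have -> : K'^-1 = 2 * (2 * K')^-1 by field; lra.
  lra.
have : eta * V t <= 4 * t * K'^-1.
  have : eta <= 4 * t * N%:R.
    have := ler_wpM2r (ltW t0) N3'; move: N2; rewrite -[N.+1%:R]natr1; lra.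
  move/(ler_wpM2r (V_ge0 t))/le_trans; apply.
  by rewrite -!mulrA ler_wpM2l // ler_wpM2l // ltW.
rewrite -ler_pdivlMl //.
by have -> : 4 / (K' * eta) * t = eta^-1 * (4 * t * K'^-1) by field; lra.
Qed.

(** With V(t) = O(t) the defect of additivity is O(s t).  Writing a time t as N s + r
    with s at most t^2, the errors in passing from x(t) to (t/s) x(s) are O(t^2), so
    |x(t)/t - x(s)/s| = O(t): comparing two times with a common much smaller one
    makes x(t)/t a Cauchy filter at 0. *)
Lemma almost_additive_derivable k :
  exists l : R, x k t / t @[t --> 0^'+] --> l.
Proof.
have [C [eta [C0 eta0 etad VC]]] := almost_additive_linear_bound.
pose D := K * C * C.
have D0 : 0 <= D by rewrite !mulr_ge0.
have xC t : 0 <= t < eta -> `|x k t| <= C * t.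
  by move=> /VC; apply: le_trans; exact: x_le_V.
have xD s t : 0 <= s -> 0 <= t -> s + t < eta ->
    `|x k (s + t) - x k s - x k t| <= D * s * t.
  move=> s0 t0 st; apply: (le_trans (x_add _ s0 t0 _)); first by lra.
  rewrite (_ : D * s * t = K * (C * s) * (C * t)); last by rewrite /D; ring.
  have Vs := VC s ltac:(by apply/andP; split; lra).
  have Vt := VC t ltac:(by apply/andP; split; lra).
  by rewrite ler_pM // ?mulr_ge0 // ler_wpM2l.
have key s t : 0 < s -> 0 < t -> t < eta -> s <= t -> s <= t ^+ 2 ->
    `|x k t / t - x k s / s| <= 2 * (D + C) * t.
  move=> s0 t0 te st st2.
  pose N := Num.trunc (t / s).
  have /andP[N1 N2] := truncn_itv (ltW (divr_gt0 t0 s0)).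
  move: N1 N2; rewrite ler_pdivlMr // ltr_pdivrMr // -/N -[N.+1%:R]natr1 => N1 N2.
  have Ns0 : 0 <= N%:R * s by rewrite mulr_ge0 ?ler0n // ltW.
  pose r := t - N%:R * s.
  have r0 : 0 <= r by rewrite subr_ge0.
  have rs : r < s by rewrite /r; lra.
  have A1 : `|x k t - x k (N%:R * s) - x k r| <= D * t * s.
    have := xD (N%:R * s) r Ns0 r0.
    rewrite (_ : N%:R * s + r = t); last by rewrite /r; ring.
    move=> /(_ te) /le_trans; apply.
    by rewrite ler_pM ?mulr_ge0 ?ler_wpM2l // ltW.
  have A2 : `|x k r| <= C * s.
    apply: (le_trans (xC r _)); first by apply/andP; split; lra.
    by rewrite ler_wpM2l // ltW.
  have A3 : `|x k (N%:R * s) - N%:R * x k s| <= D * t * t.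
    have H i : (i < N)%N ->
        `|x k (i%:R * s + s) - x k (i%:R * s) - x k s| <= D * t * s.
      move=> iN.
      have i0 : 0 <= i%:R * s by rewrite mulr_ge0 ?ler0n // ltW.
      have it : i%:R * s + s <= N%:R * s.
        by rewrite -[X in _ + X]mul1r -mulrDl ler_wpM2r ?(ltW s0) // natr1 ler_nat.
      apply: (le_trans (xD _ _ i0 (ltW s0) _)); first by lra.
      by rewrite ler_wpM2r ?(ltW s0) // ler_wpM2l //; lra.
    apply: (le_trans (almost_multiple (x_at0 k) H)).
    have -> : N%:R * (D * t * s) = D * t * (N%:R * s) by ring.
    by rewrite ler_wpM2l // mulr_ge0 // ltW.
  have A4 : `|N%:R * x k s - t / s * x k s| <= C * s.
    rewrite -mulrBl (_ : N%:R - t / s = - (r / s)); last by rewrite /r; field; lra.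
    rewrite mulNr normrN normrM ger0_norm ?divr_ge0 ?(ltW s0) //.
    have xs : `|x k s| <= C * s by apply: xC; apply/andP; split; lra.
    have rs1 : r / s <= 1 by rewrite ler_pdivrMr // mul1r ltW.
    by rewrite (le_trans _ xs) // ler_piMl.
  have -> : x k t / t - x k s / s = (x k t - t / s * x k s) / t by field; lra.
  rewrite normrM (ger0_norm (x := t^-1)) ?invr_ge0 ?(ltW t0) // ler_pdivrMr //.
  have -> : x k t - t / s * x k s = (x k t - x k (N%:R * s) - x k r) + x k r
     + (x k (N%:R * s) - N%:R * x k s) + (N%:R * x k s - t / s * x k s) by ring.
  apply: (le_trans (ler_normD _ _)).
  have := ler_normD (x k t - x k (N%:R * s) - x k r + x k r)
            (x k (N%:R * s) - N%:R * x k s).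
  have := ler_normD (x k t - x k (N%:R * s) - x k r) (x k r).
  have : D * t * s <= D * t * t by rewrite ler_wpM2l // mulr_ge0 // ltW.
  have : C * s <= C * t ^+ 2 by rewrite ler_wpM2l.
  rewrite expr2; nra.
suff /cauchy_cvgP : cauchy (x k t / t @[t --> 0^'+]).
  by move=> c; exists (lim (x k t / t @[t --> 0^'+])).
apply/cauchy_ballP => e e0; near_simpl.
pose rho := Num.min eta (e / (4 * (D + C) + 1)).
have E0 : 0 < 4 * (D + C) + 1 by rewrite ltr_pwDr // mulr_ge0 // addr_ge0.
have rho0 : 0 < rho by rewrite lt_min eta0 divr_gt0.
exists ([set t | 0 < t < rho], [set t | 0 < t < rho]) => /=.
  split; (near=> t; apply/andP; split; near: t;
    [exact: nbhs_right_gt | exact: nbhs_right_lt]).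
move=> [t1 t2] /= [/andP[t10 t1r] /andP[t20 t2r]].
(* A common time that is small enough for both comparisons. *)
pose s := Num.min (Num.min t1 t2) (Num.min (t1 ^+ 2) (t2 ^+ 2)).
have s0 : 0 < s by rewrite !lt_min t10 t20 !exprn_gt0.
have [st1 st2 st3 st4] : [/\ s <= t1, s <= t2, s <= t1 ^+ 2 & s <= t2 ^+ 2].
  by rewrite /s !ge_min !lexx ?orbT.
move: t1r t2r; rewrite !lt_min => /andP[t1e t1E] /andP[t2e t2E].
have B1 := key s t1 s0 t10 t1e st1 st3.
have B2 := key s t2 s0 t20 t2e st2 st4.
have {}t1E : t1 * (4 * (D + C) + 1) < e by rewrite -ltr_pdivlMr.
have {}t2E : t2 * (4 * (D + C) + 1) < e by rewrite -ltr_pdivlMr.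
rewrite /ball /=.
have := ler_distD (x k s / s) (x k t1 / t1) (x k t2 / t2).
rewrite (distrC (x k s / s) (x k t2 / t2)); nra.
Unshelve. all: by end_near.
Qed.

End AlmostAdditive.

(** * Uniqueness for linear systems *)

Section RealGronwall.
Variables (R : realType) (f g : R -> R) (L T : R).
Hypotheses (T0 : 0 < T) (f_ge0 : forall t, 0 <= f t).
Hypothesis f' : forall t, 0 < t < T -> is_derive t 1 f (g t).
Hypothesis g_le : forall t, 0 < t < T -> `|g t| <= L * f t.
Hypothesis f_cont0 : f t @[t --> 0^'+] --> f 0.
Hypothesis f_contT : f t @[t --> T^'-] --> f T.

(** The weights exp(- L t) and exp(L t) make f nonincreasing and nondecreasing
    respectively, which transports a zero of f in both directions. *)
Let weighted_derive (M : R) t : 0 < t < T ->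
  is_derive t 1 (fun s => f s * expR (M * s)) ((g t + M * f t) * expR (M * t)).
Proof.
move=> /f' ft.
have e' : is_derive t 1 (fun s => expR (M * s)) (expR (M * t) * M).
  have : is_derive t 1 (fun s : R => M * s) M.
    by apply: is_derive_eq; rewrite /GRing.scale /= mulr1.
  exact: (@is_derive1_comp _ expR).
have := is_deriveM ft e'.
by move=> /is_derive_eq; apply; rewrite /GRing.scale /=; ring.
Qed.

Let weighted_within (M : R) :
  {within `[0, T], continuous (fun s => f s * expR (M * s))}.
Proof.
have ec : continuous (fun s : R => expR (M * s)).
  by move=> s; apply: continuous_comp; [exact: mulrl_continuous | exact: continuous_expR].
apply/(continuous_within_itvP _ T0); split.
- move=> t /[!in_itv] /= tT; apply/differentiable_continuous/derivable1_diffP.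
  by have [] := weighted_derive M tT.
- by apply: cvgM => //; apply: cvg_at_right_filter; exact: ec.
- by apply: cvgM => //; apply: cvg_at_left_filter; exact: ec.
Qed.

Lemma real_gronwall_forward : f 0 = 0 -> f T = 0.
Proof.
move=> f0.
have H : f T * expR (- L * T) <= f 0 * expR (- L * 0).
  apply: (@ler0_derive1_le_cc _ (fun s => f s * expR (- L * s)) 0 T) => //.
  - by move=> t /[!in_itv] /= /(weighted_derive (- L)) [].
  - move=> t /[!in_itv] /= tT; rewrite derive1E.
    have [_ ->] := weighted_derive (- L) tT.
    rewrite mulr_le0_ge0 ?expR_ge0 //.
    have := ler_norm (g t); have := g_le tT; lra.
  - by rewrite in_itv /= lexx ltW.
  - by rewrite in_itv /= lexx ltW.
  - exact: ltW.
move: H; rewrite f0 mul0r pmulr_lle0 ?expR_gt0 // => H.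
by apply/eqP; rewrite eq_le H f_ge0.
Qed.

Lemma real_gronwall_backward : f T = 0 -> f 0 = 0.
Proof.
move=> fT.
have H : f 0 * expR (L * 0) <= f T * expR (L * T).
  apply: (@ger0_derive1_le_cc _ (fun s => f s * expR (L * s)) 0 T) => //.
  - by move=> t /[!in_itv] /= /(weighted_derive L) [].
  - move=> t /[!in_itv] /= tT; rewrite derive1E.
    have [_ ->] := weighted_derive L tT.
    rewrite mulr_ge0 ?expR_ge0 //.
    have := ler_norm (- g t); rewrite normrN; have := g_le tT; lra.
  - by rewrite in_itv /= lexx ltW.
  - by rewrite in_itv /= lexx ltW.
  - exact: ltW.
move: H; rewrite fT mul0r pmulr_lle0 ?expR_gt0 // => H.
by apply/eqP; rewrite eq_le H f_ge0.
Qed.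

End RealGronwall.

Section ComplexDerivative.
Variable R : realType.
Local Notation C := (Cplx R).
Local Notation rp := (@complex.Re R).
Local Notation ip := (@complex.Im R).

(** Functions of a real variable with complex values are derived part by part, so
    that the real mean value theorem stays available. *)
Definition is_cderive (t : R) (f : R -> C) (d : C) :=
  is_derive t 1 (fun s => rp (f s)) (rp d) /\
  is_derive t 1 (fun s => ip (f s)) (ip d).

Lemma is_cderive_eq t f d e : is_cderive t f d -> d = e -> is_cderive t f e.
Proof. by move=> + <-. Qed.

Lemma is_cderive_ext t f g d : f =1 g -> is_cderive t f d -> is_cderive t g d.
Proof. by move=> /funext ->. Qed.

Lemma is_cderive_cst t (c : C) : is_cderive t (fun=> c) 0.
Proof. by split => /=; exact: is_derive_cst. Qed.

Lemma is_cderiveD t f g d e : is_cderive t f d -> is_cderive t g e ->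
  is_cderive t (fun s => f s + g s) (d + e).
Proof.
move=> [f1 f2] [g1 g2]; split.
  by rewrite rpD (_ : (fun s => _) = (fun s => rp (f s)) + (fun s => rp (g s)));
    [exact: is_deriveD | apply/funext => s /=; rewrite rpD].
by rewrite ipD (_ : (fun s => _) = (fun s => ip (f s)) + (fun s => ip (g s)));
  [exact: is_deriveD | apply/funext => s /=; rewrite ipD].
Qed.

Lemma is_cderiveM t f g d e : is_cderive t f d -> is_cderive t g e ->
  is_cderive t (fun s => f s * g s) (d * g t + f t * e).
Proof.
move=> [f1 f2] [g1 g2]; split.
  rewrite (_ : (fun s => _) = (fun s => rp (f s)) * (fun s => rp (g s))
     - (fun s => ip (f s)) * (fun s => ip (g s))); last first.
    by apply/funext => s; rewrite rpM.
  apply: is_derive_eq (is_deriveB (is_deriveM f1 g1) (is_deriveM f2 g2)) _.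
  by rewrite rpD !rpM /GRing.scale /=; ring.
rewrite (_ : (fun s => _) = (fun s => rp (f s)) * (fun s => ip (g s))
     + (fun s => ip (f s)) * (fun s => rp (g s))); last first.
  by apply/funext => s; rewrite ipM.
apply: is_derive_eq (is_deriveD (is_deriveM f1 g2) (is_deriveM f2 g1)) _.
by rewrite ipD !ipM /GRing.scale /=; ring.
Qed.

Lemma is_cderiveN t f d : is_cderive t f d -> is_cderive t (fun s => - f s) (- d).
Proof.
move=> fd; have := is_cderiveM (is_cderive_cst t (-1)) fd.
rewrite mul0r add0r mulN1r.
by apply: is_cderive_ext => s; rewrite mulN1r.
Qed.

Lemma is_cderive_sum t (I : finType) (f : I -> R -> C) d :
  (forall i, is_cderive t (f i) (d i)) ->
  is_cderive t (fun s => \sum_i f i s) (\sum_i d i).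
Proof.
move=> fd; elim: index_enum => [|i r IH].
  rewrite big_nil; apply: (is_cderive_ext _ (is_cderive_cst t 0)) => s.
  by rewrite big_nil.
rewrite big_cons; apply: (is_cderive_ext _ (is_cderiveD (fd i) IH)) => s.
by rewrite big_cons.
Qed.

Lemma is_cderive_cvg t f d : is_cderive t f d -> f s @[s --> t] --> f t.
Proof.
move=> [f1 f2]; apply: cvg_parts.
  exact/(@differentiable_continuous _ _ _ _ (fun s => rp (f s)))/derivable1_diffP.
exact/(@differentiable_continuous _ _ _ _ (fun s => ip (f s)))/derivable1_diffP.
Qed.

End ComplexDerivative.

Section LinearSystem.
Variables (R : realType) (m : nat) (y : 'I_m -> R -> Cplx R).
Variables (H : R -> 'I_m -> 'I_m -> Cplx R) (K T : R).
Hypotheses (T0 : 0 < T) (K0 : 0 <= K).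
Hypothesis y' : forall t i, 0 < t < T ->
  is_cderive t (y i) (\sum_j H t i j * y j t).
Hypothesis H_le : forall t i j, 0 < t < T -> nrm (H t i j) <= K.
Hypothesis y_cont0 : forall i, y i t @[t --> 0^'+] --> y i 0.
Hypothesis y_contT : forall i, y i t @[t --> T^'-] --> y i T.
Local Notation rp := (@complex.Re R).
Local Notation ip := (@complex.Im R).

(** The energy f satisfies |f'| <= 2 K m f, by the inequality
    2 |Re(conj(a) h b)| <= |h| (|a|^2 + |b|^2). *)
Let f t := \sum_i sqn (y i t).
Let g t := \sum_i 2 * (rp (y i t) * rp (\sum_j H t i j * y j t)
                     + ip (y i t) * ip (\sum_j H t i j * y j t)).

Let f_ge0 t : 0 <= f t.
Proof. by apply: sumr_ge0 => i _; rewrite addr_ge0 ?sqr_ge0. Qed.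

Let inner_le (a h b : Cplx R) : nrm h <= K ->
  `|2 * (rp a * rp (h * b) + ip a * ip (h * b))| <= K * (sqn a + sqn b).
Proof.
move=> hK.
have -> : rp a * rp (h * b) + ip a * ip (h * b) = rp (a^* * (h * b)).
  by rewrite [RHS]rpM rp_conj ip_conj; ring.
rewrite normrM ger0_norm //.
apply: (@le_trans _ _ (2 * (nrm a * (K * nrm b)))).
  rewrite ler_wpM2l // (le_trans (rp_le_nrm _)) // !nrmM.
  have -> : nrm a^* = nrm a by rewrite /nrm norm_conjC.
  by rewrite ler_wpM2l ?nrm_ge0 // ler_wpM2r ?nrm_ge0.
rewrite !sqnE (_ : 2 * _ = K * (2 * nrm a * nrm b)); last by ring.
by rewrite ler_wpM2l // -subr_ge0 (_ : _ - _ = (nrm a - nrm b) ^+ 2)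
  ?sqr_ge0 //; ring.
Qed.

Let f' t : 0 < t < T -> is_derive t 1 f (g t).
Proof.
move=> tT.
suff S i : is_derive t 1 (fun s => sqn (y i s))
    (2 * (rp (y i t) * rp (\sum_j H t i j * y j t)
        + ip (y i t) * ip (\sum_j H t i j * y j t))).
  rewrite (_ : f = \sum_i (fun s => sqn (y i s))); first exact: is_derive_sum.
  by apply/funext => s; rewrite fct_sumE.
have [d1 d2] := y' i tT.
rewrite (_ : (fun s => _) = (fun s => rp (y i s)) * (fun s => rp (y i s))
                          + (fun s => ip (y i s)) * (fun s => ip (y i s))).
  apply: is_derive_eq (is_deriveD (is_deriveM d1 d1) (is_deriveM d2 d2)) _.
  by rewrite /GRing.scale /=; ring.
by apply/funext => s; rewrite /sqn !expr2.
Qed.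

Let g_le t : 0 < t < T -> `|g t| <= (K * m%:R * 2) * f t.
Proof.
move=> tT; rewrite (le_trans (ler_norm_sum _ _ _)) //.
apply: (@le_trans _ _ (\sum_i \sum_j K * (sqn (y i t) + sqn (y j t)))).
  apply: ler_sum => i _.
  rewrite rp_sum ip_sum !mulr_sumr -big_split /= mulr_sumr.
  rewrite (le_trans (ler_norm_sum _ _ _)) //.
  by apply: ler_sum => j _; apply: inner_le; exact: H_le.
rewrite le_eqVlt; apply/orP; left; apply/eqP.
under eq_bigr do rewrite -mulr_sumr big_split /= sumr_const card_ord.
rewrite -mulr_sumr big_split /= sumr_const card_ord -/(f t) sumrMnl -/(f t).
by rewrite -!(mulr_natr (f t)); ring.
Qed.

Let f_cvg (F : set_system R) (FF : Filter F) s :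
  (forall i, y i t @[t --> F] --> y i s) -> f t @[t --> F] --> f s.
Proof.
move=> yF; rewrite /f /sqn.
apply: (@cvg_sumr _ _ _ F FF _ (fun i t => rp (y i t) ^+ 2 + ip (y i t) ^+ 2)) => i.
by rewrite !expr2; under eq_fun do rewrite !expr2; apply: cvgD; apply: cvgM;
  solve [exact: cvg_rp | exact: cvg_ip].
Qed.

Let f0_y s : f s = 0 -> forall i, y i s = 0.
Proof.
move=> /eqP; rewrite psumr_eq0 => [/allP fs i|i _]; last first.
  by rewrite addr_ge0 ?sqr_ge0.
have /eqP := fs i (mem_index_enum _).
by rewrite sqnE => /eqP; rewrite sqrf_eq0 nrm_eq0 => /eqP.
Qed.

Let y0_f s : (forall i, y i s = 0) -> f s = 0.
Proof. by move=> ys; rewrite /f big1 // => i _; rewrite ys /sqn rp0 ip0 expr0n addr0. Qed.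

Lemma linear_system_zero_forward :
  (forall i, y i 0 = 0) -> forall i, y i T = 0.
Proof.
move=> /y0_f yz; apply: f0_y.
apply: (@real_gronwall_forward _ f g _ T T0 f_ge0 f' g_le _ _ yz).
  exact: (f_cvg _ y_cont0).
exact: (f_cvg _ y_contT).
Qed.

Lemma linear_system_zero_backward :
  (forall i, y i T = 0) -> forall i, y i 0 = 0.
Proof.
move=> /y0_f yz; apply: f0_y.
apply: (@real_gronwall_backward _ f g _ T T0 f_ge0 f' g_le _ _ yz).
  exact: (f_cvg _ y_cont0).
exact: (f_cvg _ y_contT).
Qed.

End LinearSystem.

(** * The exponential of a complex matrix *)

Section RealEgf.
Variable R : realType.
Implicit Types (p q : nat -> R) (t : R).

Definition geom_bounded p :=
  exists B c : R, [/\ 0 <= B, 0 <= c & forall k, `|p k| <= B * c ^+ k].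

(** Differentiation of an exponential generating function shifts its coefficients;
    applied to the entries of the powers of a matrix this gives E' = L E. *)
Definition egf p t : R := limn (pseries (fun k => p k / k`!%:R) t).

Lemma geom_bounded_shift p : geom_bounded p -> geom_bounded (fun k => p k.+1).
Proof.
move=> [B [c [B0 c0 pk]]]; exists (B * c), c; split; rewrite ?mulr_ge0 // => k.
by rewrite -mulrA -exprS.
Qed.

Lemma cvg_egf p t : geom_bounded p -> cvgn (pseries (fun k => p k / k`!%:R) t).
Proof.
move=> [B [c [B0 c0 pk]]]; apply: normed_cvg.
apply: (@series_le_cvg _ _ (fun k => B * exp_coeff (c * `|t|) k)) => [k|k|k|] //=.
- by rewrite mulr_ge0 // /exp_coeff /= divr_ge0 // exprn_ge0 // mulr_ge0.
- rewrite /exp_coeff /= !normrM normfV normrX exprMn (ger0_norm (ler0n _ _)).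
  rewrite (_ : B * _ = B * c ^+ k * (`|t| ^+ k / k`!%:R)); last by ring.
  rewrite mulrAC -mulrA ler_wpM2r ?pk // divr_ge0 ?exprn_ge0 ?ler0n //.
- have := @is_cvg_seriesZ _ _ B (is_cvg_series_exp_coeff (c * `|t|)).
  by [].
Qed.

Lemma pseries_diffs_egf p :
  pseries_diffs (fun k => p k / k`!%:R) = (fun k => p k.+1 / k`!%:R).
Proof.
apply/funext => k; rewrite /pseries_diffs factS natrM; field.
by rewrite nat1r !pnatr_eq0 -lt0n fact_gt0.
Qed.

Lemma is_derive_egf p t : geom_bounded p ->
  is_derive t 1 (egf p) (egf (fun k => p k.+1) t).
Proof.
move=> pb; have pb1 := geom_bounded_shift pb; have pb2 := geom_bounded_shift pb1.
rewrite /egf -pseries_diffs_egf.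
apply: (@pseries_snd_diffs _ _ (`|t| + 1)).
- exact: cvg_egf.
- by rewrite pseries_diffs_egf; exact: cvg_egf.
- by rewrite !(pseries_diffs_egf, pseries_diffs_egf (fun k => p k.+1)); exact: cvg_egf.
- by rewrite [ltRHS]ger0_norm ?addr_ge0 // ltrDl.
Qed.

Lemma egf0 p : egf p 0 = p 0%N.
Proof.
rewrite /egf; apply: lim_near_cst => //.
near=> m; rewrite -[m]prednK; last by near: m; exact: nbhs_infty_gt.
rewrite /pseries /series /= big_nat_recl //= fact0 divr1 expr0 mulr1 big1 ?addr0 //.
by move=> i _; rewrite exprS mul0r mulr0.
Unshelve. all: by end_near. Qed.

Lemma egf_linear a b p q t : geom_bounded p -> geom_bounded q ->
  egf (fun k => a * p k + b * q k) t = a * egf p t + b * egf q t.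
Proof.
move=> pb qb; rewrite /egf; apply: cvg_lim => //.
rewrite (_ : pseries _ t = a \*: pseries (fun k => p k / k`!%:R) t
                         + b \*: pseries (fun k => q k / k`!%:R) t).
  by apply: cvgD; apply: cvgZr; exact: cvg_egf.
apply/funext => n; rewrite /pseries /series /= fctE /GRing.scale /=.
by rewrite !scaler_sumr -big_split; apply: eq_bigr => i _; rewrite /GRing.scale /=; ring.
Qed.

End RealEgf.

Section ComplexEgf.
Variable R : realType.
Local Notation C := (Cplx R).
Local Notation rp := (@complex.Re R).
Local Notation ip := (@complex.Im R).
Implicit Types (p q : nat -> C) (t : R).

Definition cgeom_bounded p :=
  exists B c : R, [/\ 0 <= B, 0 <= c & forall k, nrm (p k) <= B * c ^+ k].

(** Both parts are real power series, hence derivable term by term. *)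
Definition cegf p t : C :=
  Complex (egf (fun k => rp (p k)) t) (egf (fun k => ip (p k)) t).

Lemma cgeom_bounded_rp p : cgeom_bounded p -> geom_bounded (fun k => rp (p k)).
Proof.
move=> [B [c [B0 c0 pk]]]; exists B, c; split=> // k.
exact: (le_trans (rp_le_nrm _)).
Qed.

Lemma cgeom_bounded_ip p : cgeom_bounded p -> geom_bounded (fun k => ip (p k)).
Proof.
move=> [B [c [B0 c0 pk]]]; exists B, c; split=> // k.
exact: (le_trans (ip_le_nrm _)).
Qed.

Lemma cgeom_bounded0 : cgeom_bounded (fun=> 0).
Proof. by exists 0, 0; split => // k; rewrite nrm0 mul0r. Qed.

Lemma cgeom_boundedMD a p q : cgeom_bounded p -> cgeom_bounded q ->
  cgeom_bounded (fun k => a * p k + q k).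
Proof.
move=> [B [c [B0 c0 pk]]] [B' [c' [B0' c0' qk]]].
exists (nrm a * B + B'), (Num.max c c'); split.
- by rewrite addr_ge0 ?mulr_ge0 ?nrm_ge0.
- by rewrite le_max c0.
move=> k; rewrite (le_trans (nrmD _ _)) // mulrDl lerD // ?nrmM -?mulrA.
  rewrite ler_wpM2l ?nrm_ge0 // (le_trans (pk k)) // ler_wpM2l // lerXn2r //.
    by rewrite nnegrE le_max c0.
  by rewrite le_max lexx.
rewrite (le_trans (qk k)) // ler_wpM2l // lerXn2r //.
  by rewrite nnegrE le_max c0.
by rewrite le_max lexx orbT.
Qed.

Lemma is_cderive_cegf p t : cgeom_bounded p ->
  is_cderive t (cegf p) (cegf (fun k => p k.+1) t).
Proof.
move=> pb; split => /=; apply: is_derive_egf.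
  exact: cgeom_bounded_rp.
exact: cgeom_bounded_ip.
Qed.

Lemma cegf0 p : cegf p 0 = p 0%N.
Proof. by rewrite /cegf !egf0; case: (p 0%N). Qed.

Lemma cegfMD a p q t : cgeom_bounded p -> cgeom_bounded q ->
  cegf (fun k => a * p k + q k) t = a * cegf p t + cegf q t.
Proof.
move=> pb qb.
have [pr pi] := (cgeom_bounded_rp pb, cgeom_bounded_ip pb).
have [qr qi] := (cgeom_bounded_rp qb, cgeom_bounded_ip qb).
have mpr : geom_bounded (fun k => rp (a * p k)).
  apply: cgeom_bounded_rp.
  have := cgeom_boundedMD a pb cgeom_bounded0.
  by under eq_fun do rewrite addr0.
have mpi : geom_bounded (fun k => ip (a * p k)).
  apply: cgeom_bounded_ip.
  have := cgeom_boundedMD a pb cgeom_bounded0.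
  by under eq_fun do rewrite addr0.
apply: cplx_eq; rewrite ?rpD ?ipD ?rpM ?ipM /=.
  rewrite (_ : (fun k => _) = (fun k => 1 * rp (a * p k) + 1 * rp (q k))); last first.
    by apply/funext => k; rewrite rpD !mul1r.
  rewrite egf_linear // !mul1r.
  rewrite (_ : (fun k => _) = (fun k => rp a * rp (p k) + (- ip a) * ip (p k))).
    by rewrite egf_linear // mulNr.
  by apply/funext => k; rewrite rpM mulNr.
rewrite (_ : (fun k => _) = (fun k => 1 * ip (a * p k) + 1 * ip (q k))); last first.
  by apply/funext => k; rewrite ipD !mul1r.
rewrite egf_linear // !mul1r.
rewrite (_ : (fun k => _) = (fun k => rp a * ip (p k) + ip a * rp (p k))).
  by rewrite egf_linear.
by apply/funext => k; rewrite ipM.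
Qed.

Lemma cegf_sum (I : finType) (a : I -> C) (p : I -> nat -> C) t :
  (forall i, cgeom_bounded (p i)) ->
  cegf (fun k => \sum_i a i * p i k) t = \sum_i a i * cegf (p i) t.
Proof.
move=> pb.
suff [] : cgeom_bounded (fun k => \sum_i a i * p i k) /\
  cegf (fun k => \sum_i a i * p i k) t = \sum_i a i * cegf (p i) t by [].
elim: index_enum => [|i r [IH1 IH2]].
  rewrite big_nil (_ : (fun k => _) = (fun=> 0)); last first.
    by apply/funext => k; rewrite big_nil.
  split; first exact: cgeom_bounded0.
  apply: (addrI (cegf (fun=> 0) t)).
  have := cegfMD 1 t cgeom_bounded0 cgeom_bounded0.
  by rewrite mulr0 addr0 mul1r => <-; rewrite addr0.
rewrite big_cons (_ : (fun k => _) =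
    (fun k => a i * p i k + \sum_(j <- r) a j * p j k)); last first.
  by apply/funext => k; rewrite big_cons.
by split; [exact: cgeom_boundedMD | rewrite cegfMD // IH2].
Qed.

End ComplexEgf.

Lemma nrm_entry_le_sum (R : realType) (p q : nat) (A : 'M[Cplx R]_(p, q)) i j :
  nrm (A i j) <= \sum_k \sum_l nrm (A k l).
Proof.
have row_ge0 k : 0 <= \sum_l nrm (A k l) by apply: sumr_ge0 => l _; exact: nrm_ge0.
rewrite (bigD1 i) //= (bigD1 j) //= -addrA lerDl addr_ge0 //.
  by apply: sumr_ge0 => l _; exact: nrm_ge0.
by apply: sumr_ge0 => k _; exact: row_ge0.
Qed.

Section MatrixExponential.
Variables (R : realType) (m : nat) (L : 'M[Cplx R]_m).

Definition expm (t : R) : 'M[Cplx R]_m :=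
  \matrix_(i, j) cegf (fun k => (L ^+ k) i j) t.

Lemma cgeom_bounded_powers i j : cgeom_bounded (fun k => (L ^+ k) i j).
Proof.
pose K := \sum_i \sum_j nrm (L i j).
have LK a b : nrm (L a b) <= K by exact: nrm_entry_le_sum.
have K0 : 0 <= K by apply: sumr_ge0 => ? _; apply: sumr_ge0 => ? _; exact: nrm_ge0.
have mK0 : 0 <= m%:R * K by rewrite mulr_ge0 ?ler0n.
exists 1, (m%:R * K); split => // k; rewrite mul1r.
elim: k i j => [|k IH] i j.
  rewrite !expr0 mxE; case: eqP => _ /=; rewrite ?mulr1n ?mulr0n.
    by rewrite nrm1.
  by rewrite nrm0.
rewrite exprS mxE (le_trans (nrm_sum _)) // exprS -mulrA.
rewrite (_ : m%:R * _ = \sum_(l < m) (K * (m%:R * K) ^+ k)); last first.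
  by rewrite sumr_const card_ord mulr_natl.
by apply: ler_sum => l _; rewrite nrmM ler_pM ?nrm_ge0.
Qed.

Lemma expm0 : expm 0 = 1%:M.
Proof. by apply/matrixP => i j; rewrite mxE cegf0 expr0. Qed.

Lemma is_cderive_expm t i j :
  is_cderive t (fun s => expm s i j) (\sum_l L i l * expm t l j).
Proof.
apply: (is_cderive_ext (f := cegf (fun k => (L ^+ k) i j))).
  by move=> s; rewrite mxE.
apply: is_cderive_eq (is_cderive_cegf t (cgeom_bounded_powers i j)) _.
under [RHS]eq_bigr do rewrite mxE.
rewrite -cegf_sum; last by move=> l; exact: cgeom_bounded_powers.
by congr cegf; apply/funext => k; rewrite exprS mxE.
Qed.

Lemma is_cderive_expm_mul (v : 'cV[Cplx R]_m) t i :
  is_cderive t (fun s => (expm s *m v) i ord0)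
    (\sum_l L i l * (expm t *m v) l ord0).
Proof.
apply: (is_cderive_ext (f := fun s => \sum_j expm s i j * v j ord0)).
  by move=> s; rewrite mxE.
apply: is_cderive_eq.
  apply: is_cderive_sum => j.
  exact: (is_cderiveM (is_cderive_expm t i j) (is_cderive_cst t (v j ord0))).
rewrite (eq_bigr (fun j => \sum_l L i l * expm t l j * v j ord0)); last first.
  by move=> j _; rewrite mulr0 addr0 mulr_suml.
rewrite exchange_big; apply: eq_bigr => l _.
by rewrite mxE mulr_sumr; apply: eq_bigr => j _; rewrite mulrA.
Qed.

(** A solution that vanishes at time t vanishes at time 0, by uniqueness backwards
    in time. *)
Lemma expm_inj (v : 'cV[Cplx R]_m) t : 0 <= t -> expm t *m v = 0 -> v = 0.
Proof.
rewrite le_eqVlt => /predU1P[<-|t0]; first by rewrite expm0 mul1mx.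
move=> ev.
pose K := \sum_i \sum_j nrm (L i j).
have LK a b : nrm (L a b) <= K by exact: nrm_entry_le_sum.
have K0 : 0 <= K by apply: sumr_ge0 => ? _; apply: sumr_ge0 => ? _; exact: nrm_ge0.
have vc s i : (expm r *m v) i ord0 @[r --> s] --> (expm s *m v) i ord0.
  exact: (is_cderive_cvg (is_cderive_expm_mul v s i)).
pose Y i s := (expm s *m v) i ord0.
have Y0 i : Y i s @[s --> 0^'+] --> Y i 0.
  exact: (cvg_at_right_filter (vc 0 i)).
have Yt i : Y i s @[s --> t^'-] --> Y i t.
  exact: (cvg_at_left_filter (vc t i)).
have Yd s i : 0 < s < t -> is_cderive s (Y i) (\sum_j L i j * Y j s).
  by move=> _; exact: is_cderive_expm_mul.
have Yt0 i : Y i t = 0 by rewrite /Y ev mxE.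
have := @linear_system_zero_backward R m Y (fun=> L) K t t0 K0 Yd
  (fun _ a b _ => LK a b) Y0 Yt Yt0.
by move=> Yz; apply/matrixP => i j; rewrite (ord1 j) [RHS]mxE -(Yz i) /Y expm0 mul1mx.
Qed.

End MatrixExponential.

(** * The Euclidean ball *)

Section Euclid.
Variables (R : realType) (n : nat).
Local Notation C := (Cplx R).
Implicit Types (z w : 'cV[C]_n).

Definition esq z : R := \sum_j sqn (z j ord0).

Lemma mul_conj_sqn (x : C) : x * x^* = rc (sqn x).
Proof. by rewrite -normCK sqnE nrmE expr2 -rcM -expr2. Qed.

Lemma rc_sum (I : finType) (F : I -> R) : rc (\sum_i F i) = \sum_i rc (F i).
Proof. exact: (big_morph (@rc R) (@rcD R) (@rc0 R)). Qed.

Lemma cdot_self z : cdot z z = rc (esq z).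
Proof. by rewrite /cdot /esq rc_sum; apply: eq_bigr => j _; exact: mul_conj_sqn. Qed.

Lemma sqn_ge0 (x : C) : 0 <= sqn x.
Proof. by rewrite addr_ge0 ?sqr_ge0. Qed.

Lemma esq_ge0 z : 0 <= esq z.
Proof. by apply: sumr_ge0 => j _; exact: sqn_ge0. Qed.

Lemma enormE z : enorm z = rc (Num.sqrt (esq z)).
Proof.
rewrite /enorm cdot_self -{1}(sqr_sqrtr (esq_ge0 z)) expr2 rcM -expr2.
by rewrite sqrCK // -rc0 rc_le sqrtr_ge0.
Qed.

Lemma cballE z : cball R n z <-> esq z < 1.
Proof.
rewrite /cball /= enormE -rc1 rc_lt -[X in _ < X]sqrtr1 ltr_sqrt //; split => //.
Qed.

Lemma csphereE z : csphere R n z <-> esq z = 1.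
Proof.
rewrite /csphere /= enormE; split => [|->]; last by rewrite sqrtr1.
rewrite -rc1 => /rcI; rewrite -[X in _ = X]sqrtr1 => /eqP.
by rewrite eqr_sqrt ?esq_ge0 // => /eqP.
Qed.

Lemma enorm_lt_norm z (D : C) : (enorm z < `|D|) = (esq z < sqn D).
Proof.
rewrite enormE nrmE rc_lt sqnE.
rewrite -{2}(sqr_sqrtr (esq_ge0 z)) ltr_pXn2r // nnegrE ?sqrtr_ge0 //.
exact: nrm_ge0.
Qed.

Lemma sqn_le_esq z j : sqn (z j ord0) <= esq z.
Proof. by rewrite /esq (bigD1 j) //= lerDl sumr_ge0 // => *; exact: sqn_ge0. Qed.

Lemma cball_coord z j : cball R n z -> nrm (z j ord0) <= 1.
Proof.
move=> /cballE z1; rewrite -(@ler_pXn2r _ 2) ?nnegrE ?nrm_ge0 // -sqnE expr1n.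
exact: (le_trans (sqn_le_esq z j) (ltW z1)).
Qed.

Lemma sqnM (x y : C) : sqn (x * y) = sqn x * sqn y.
Proof. by rewrite !sqnE nrmM exprMn. Qed.

Lemma esqZ (x : C) z : esq (x *: z) = sqn x * esq z.
Proof. by rewrite /esq mulr_sumr; apply: eq_bigr => j _; rewrite mxE sqnM. Qed.

Lemma cball0 : cball R n 0.
Proof. by apply/cballE; rewrite /esq big1 // => j _; rewrite mxE /sqn rp0 ip0 expr0n addr0. Qed.

End Euclid.

(** * Time derivatives of a semigroup *)

Section TimeDerivative.
Variable R : realType.
Local Notation C := (Cplx R).
Local Notation rp := (@complex.Re R).
Local Notation ip := (@complex.Im R).

Lemma is_derive_quotient (f : R -> R) (t d : R) :
  h^-1 * (f (t + h) - f t) @[h --> 0^'] --> d -> is_derive t 1 f d.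
Proof.
move=> H.
have E : (fun h : R => h^-1 *: ((f \o shift t) (h *: 1) - f t))
       = (fun h => h^-1 * (f (t + h) - f t)).
  by apply/funext => h /=; rewrite /GRing.scale /= mulr1 (addrC h t).
split; first by rewrite /derivable E; apply/cvg_ex; exists d.
by rewrite /derive E; apply: cvg_lim.
Qed.

Lemma is_cderive_quotient (f : R -> C) (t : R) (d : C) :
  (rc h)^-1 * (f (t + h) - f t) @[h --> 0^'] --> d -> is_cderive t f d.
Proof.
move=> H; split; apply: is_derive_quotient.
  rewrite (_ : (fun h => _) = fun h => rp ((rc h)^-1 * (f (t + h) - f t))).
    exact: cvg_rp H.
  by apply/funext => h; rewrite -rcV rp_rcM rpB.
rewrite (_ : (fun h => _) = fun h => ip ((rc h)^-1 * (f (t + h) - f t))).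
  exact: cvg_ip H.
by apply/funext => h; rewrite -rcV ip_rcM ipB.
Qed.

Variables (n : nat) (phi : R -> 'cV[C]_n -> 'cV[C]_n) (G : 'cV[C]_n -> 'cV[C]_n).
Hypothesis hphi : continuous_semigroup phi.

Lemma generator_is_cderive : infinitesimal_generator phi G ->
  forall t z i, 0 < t -> cball R n z ->
  is_cderive t (fun s => phi s z i ord0) (G (phi t z) i ord0).
Proof.
move=> [_ H] t z i t0 zB; apply: is_cderive_quotient.
have {}H := H t z (ltW t0) zB.
have E := @coord_continuous C n 1 i ord0 (G (phi t z)).
have {E}H := cvg_comp _ _ H E.
rewrite (_ : (fun h => _) =
    (fun h : R => ((rc h)^-1 *: (phi (t + h) z - phi t z)) i ord0)); last first.
  by apply/funext => h; rewrite !mxE.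
apply: cvg_trans; last exact: H.
move=> P /=; rewrite /nbhs /= /within /= => HP.
near=> h; apply: (near HP h) => //=.
have : `|h| < t by near: h; exact: dnbhs0_lt.
by rewrite ltr_norml => /andP[]; lra.
Unshelve. all: by end_near. Qed.

Lemma semigroup_cvg0 z i : cball R n z ->
  phi t z i ord0 @[t --> 0^'+] --> z i ord0.
Proof.
move=> zB.
have sub : [set z] `<=` cball R n by move=> _ ->.
have := semigroup_continuous hphi (@compact_set1 _ z) sub.
rewrite uniform_set1 => /= H.
exact: (cvg_comp _ _ H (@coord_continuous C n 1 i ord0 z)).
Qed.
End TimeDerivative.

(** * From the generator to linear fractional maps *)

Section Linearization.
Variables (R : realType) (n : nat).
Local Notation C := (Cplx R).
Variables (phi : R -> 'cV[C]_n -> 'cV[C]_n).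
Hypothesis hphi : continuous_semigroup phi.
Variables (a b : 'cV[C]_n) (A : 'M[C]_n).
Let G z := a - cdot z a *: z - (A *m z + cdot z b *: z).
Hypothesis hG : infinitesimal_generator phi G.

Let gam j : C := (a j ord0)^* + (b j ord0)^*.

Definition conj_row (v : 'cV[C]_n) : 'rV[C]_n := (map_mx Num.conj v)^T.

(** The linear system w' = - A w + s a, s' = <w, a + b>, whose projection z = w / s
    follows the vector field G. *)
Definition linearization : 'M[C]_(n + 1) :=
  block_mx (- A) a (conj_row (a + b)) 0.

Let E t := expm linearization t.
Let top t (z : 'cV[C]_n) i : C := (E t *m col_mx z 1%:M) (lshift 1 i) ord0.
Let bot t (z : 'cV[C]_n) : C := (E t *m col_mx z 1%:M) (rshift n ord0) ord0.

Let G_coord z i : G z i ord0 =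
  a i ord0 - (\sum_j gam j * z j ord0) * z i ord0 - \sum_j A i j * z j ord0.
Proof.
rewrite /G !mxE /cdot.
rewrite (_ : \sum_j gam j * z j ord0 =
   \sum_j z j ord0 * (a j ord0)^* + \sum_j z j ord0 * (b j ord0)^*).
  by ring.
by rewrite -big_split; apply: eq_bigr => j _; rewrite /gam /=; ring.
Qed.

Let top' t z i : is_cderive t (fun s => top s z i)
  (- (\sum_j A i j * top t z j) + a i ord0 * bot t z).
Proof.
apply: is_cderive_eq (is_cderive_expm_mul linearization _ t (lshift 1 i)) _.
rewrite big_split_ord /= big_ord1 -sumrN; congr (_ + _).
  by apply: eq_bigr => j _; rewrite block_mxEul mxE mulNr.
by rewrite block_mxEur.
Qed.

Let bot' t z : is_cderive t (fun s => bot s z) (\sum_j gam j * top t z j).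
Proof.
apply: is_cderive_eq (is_cderive_expm_mul linearization _ t (rshift n ord0)) _.
rewrite big_split_ord /= big_ord1 block_mxEdr mxE mul0r addr0.
by apply: eq_bigr => j _; rewrite block_mxEdl; congr (_ * _); rewrite !mxE rmorphD.
Qed.

Let flow_bounded t z i : 0 <= t -> cball R n z -> nrm (phi t z i ord0) <= 1.
Proof. by move=> t0 zB; apply: cball_coord; exact: semigroup_selfmap. Qed.

(** The difference y = w - s phi_t(z) solves y' = - A y - <y, a + b> phi_t(z), since
    the terms of s G(phi_t(z)) cancel; this linear system has bounded coefficients
    because the flow stays in the ball. *)
Lemma linearized_flow t z i : 0 <= t -> cball R n z ->
  top t z i = bot t z * phi t z i ord0.
Proof.
move=> t0 zB; apply/eqP; rewrite -subr_eq0; apply/eqP.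
pose y i r := top r z i - bot r z * phi r z i ord0.
have y0 j : y j 0 = 0.
  rewrite /y /top /bot /E expm0 mul1mx col_mxEu col_mxEd mxE eqxx mulr1n mul1r.
  by rewrite (semigroup0 hphi) // subrr.
move: t0; rewrite le_eqVlt => /predU1P[<-|t0]; first exact: y0.
pose H r i j := - A i j - gam j * phi r z i ord0.
pose K := \sum_i \sum_j nrm (A i j) + \sum_j nrm (gam j).
have K0 : 0 <= K.
  rewrite addr_ge0 //; apply: sumr_ge0 => k _; last exact: nrm_ge0.
  by apply: sumr_ge0 => l _; exact: nrm_ge0.
have HK r k l : 0 < r < t -> nrm (H r k l) <= K.
  move=> /andP[r0 _]; rewrite (le_trans (nrmB _ _)) // nrmN lerD //.
    exact: nrm_entry_le_sum.
  rewrite nrmM (bigD1 l) //= -[X in X <= _]addr0 lerD //.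
    by rewrite ler_piMr ?nrm_ge0 // flow_bounded // ltW.
  by apply: sumr_ge0 => ? _; exact: nrm_ge0.
have phi' r k : 0 < r -> is_cderive r (fun s => phi s z k ord0) (G (phi r z) k ord0).
  by move=> r0; exact: (generator_is_cderive hG).
have y' r k : 0 < r -> is_cderive r (y k) (\sum_j H r k j * y j r).
  move=> r0; apply: is_cderive_eq.
    apply: is_cderiveD; first exact: top'.
    apply: is_cderiveN; apply: is_cderiveM; first exact: bot'.
    exact: phi'.
  rewrite G_coord.
  rewrite [RHS](eq_bigr (fun j => - (A k j * top r z j) + bot r z * (A k j * phi r z j ord0)
     + (- phi r z k ord0) * (gam j * top r z j)
     + (bot r z * phi r z k ord0) * (gam j * phi r z j ord0))); last first.
    by move=> j _; rewrite /H /y; ring.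
  rewrite !big_split /= -!mulr_sumr sumrN; ring.
have yt k : y k s @[s --> t^'-] --> y k t.
  exact: (cvg_at_left_filter (is_cderive_cvg (y' t k t0))).
have y0c k : y k s @[s --> 0^'+] --> y k 0.
  apply: cvgB; first exact: (cvg_at_right_filter (is_cderive_cvg (top' 0 z k))).
  apply: cvgM; first exact: (cvg_at_right_filter (is_cderive_cvg (bot' 0 z))).
  by rewrite (semigroup0 hphi) //; exact: semigroup_cvg0.
exact: (@linear_system_zero_forward R n y H K t t0 K0
  (fun r k rt => y' r k (proj1 (andP rt))) HK y0c yt y0 i).
Qed.

Let col_mx_one_neq0 (z : 'cV[C]_n) t : 0 <= t -> E t *m col_mx z 1%:M <> 0.
Proof.
move=> t0 /(expm_inj t0) /(congr1 (fun v : 'cV[C]_(n + 1) => v (rshift n ord0) ord0)) /eqP.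
by rewrite col_mxEd !mxE eqxx mulr1n oner_eq0.
Qed.

(** The numerator and the denominator have no common zero, even outside the ball. *)
Let topbot_neq0 (z : 'cV[C]_n) t : 0 <= t ->
  (forall i, top t z i = 0) -> bot t z <> 0.
Proof.
move=> t0 tz bz; apply: (@col_mx_one_neq0 z t t0).
apply/matrixP => i j; rewrite (ord1 j) [RHS]mxE.
case: (split_ordP i) => k ->; first exact: tz.
by rewrite (ord1 k); exact: bz.
Qed.

Section Time.
Variable t : R.
Hypothesis t0 : 0 <= t.
Let M := ulsubmx (E t).
Let B := ursubmx (E t).
Let Cr := dlsubmx (E t).
Let D : C := drsubmx (E t) ord0 ord0.

Let topE z i : top t z i = (M *m z + B) i ord0.
Proof.
by rewrite /top -{1}(submxK (E t)) mul_block_col mulmx1 col_mxEu.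
Qed.

Let botE z : bot t z = \sum_j Cr ord0 j * z j ord0 + D.
Proof.
by rewrite /bot -{1}(submxK (E t)) mul_block_col !mulmx1 col_mxEd mxE [X in X + _]mxE.
Qed.

Let cdotE z : cdot z (map_mx Num.conj Cr)^T = \sum_j Cr ord0 j * z j ord0.
Proof. by apply: eq_bigr => j _; rewrite !mxE conjCK mulrC. Qed.

Let bot_neq0 z : cball R n z -> bot t z <> 0.
Proof.
move=> zB bz; apply: (topbot_neq0 (z := z) t0 _ bz) => i.
by rewrite (linearized_flow i t0 zB) bz mul0r.
Qed.

Let flowE z : cball R n z -> phi t z = (bot t z)^-1 *: (M *m z + B).
Proof.
move=> zB; apply/matrixP => i j; rewrite (ord1 j) [RHS]mxE -topE.
by rewrite linearized_flow // mulKf //; apply/eqP; exact: bot_neq0.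
Qed.

Let D_neq0 : D != 0.
Proof.
apply/eqP => D0; apply: (@bot_neq0 0 (@cball0 _ _)).
by rewrite botE D0 big1 ?addr0 // => j _; rewrite [X in _ * X]mxE mulr0.
Qed.

(** If |D| <= |C|, then u = - (D / |C|^2) C lies in the closed ball and the
    denominator vanishes at u.  On the segment from 0 to u the numerator is bounded
    by the denominator, so it vanishes at u as well. *)
Let denominator_dominates : enorm (map_mx Num.conj Cr)^T < `|D|.
Proof.
pose c := (map_mx Num.conj Cr)^T; rewrite -/c enorm_lt_norm.
rewrite ltNge; apply/negP => DC.
have D0 : 0 < sqn D.
  by rewrite lt_def sqn_ge0 andbT sqnE sqrf_eq0 nrm_eq0.
have N0 : 0 < esq c by exact: lt_le_trans DC.
pose u : 'cV[C]_n := (- D / rc (esq c)) *: c.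
have Cu : \sum_j Cr ord0 j * u j ord0 = - D.
  rewrite -cdotE -/c /cdot.
  rewrite (_ : \sum_j _ = (- D / rc (esq c)) * cdot c c); last first.
    by rewrite /cdot mulr_sumr; apply: eq_bigr => j _; rewrite mxE mulrA.
  by rewrite cdot_self mulfVK // rc_eq0 gt_eqF.
have u1 : esq u <= 1.
  rewrite esqZ.
  have -> : sqn (- D / rc (esq c)) = sqn D / esq c ^+ 2.
    by rewrite sqnM !sqnE nrmN nrmV nrm_rc gtr0_norm // exprVn.
  rewrite (_ : _ * _ = sqn D / esq c); last by field; lra.
  by rewrite ler_pdivrMr // mul1r.
move: u Cu u1 => u Cu u1.
apply: (topbot_neq0 (z := u) t0); last by rewrite botE Cu addNr.
move=> i; apply/eqP; rewrite -nrm_eq0 eq_le nrm_ge0 andbT.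
set V := (M *m u) i ord0.
pose k := nrm V + nrm D.
have k0 : 0 <= k by rewrite addr_ge0 ?nrm_ge0.
(* At the point (1 - e) u the denominator is e D, and the numerator differs by e M u
   from its value at u. *)
have H e : 0 < e -> e < 1 -> nrm (top t u i) <= e * k.
  move=> e0 e1; pose r := 1 - e.
  have ruB : cball R n (rc r *: u).
    apply/cballE; rewrite esqZ sqnE nrm_rc ger0_norm ?subr_ge0 ?ltW //.
    have := esq_ge0 u; have : r ^+ 2 < 1 by rewrite /r; nra.
    have : 0 <= r ^+ 2 by rewrite sqr_ge0.
    nra.
  have b1 : bot t (rc r *: u) = rc e * D.
    rewrite botE (eq_bigr (fun j => rc r * (Cr ord0 j * u j ord0))); last first.
      by move=> j _; rewrite [X in _ * X]mxE; ring.
    by rewrite -mulr_sumr Cu /r rcD rcN rc1; ring.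
  have b2 : top t u i = top t (rc r *: u) i + rc e * V.
    rewrite !topE -(scalemxAr (rc r)) /V; move: (M *m u) B => W B'.
    by rewrite !mxE /r rcD rcN rc1; ring.
  rewrite b2 (le_trans (nrmD _ _)) // linearized_flow // b1 !nrmM nrm_rc gtr0_norm //.
  rewrite /k mulrDr addrC lerD2l -[X in _ <= X]mulr1 ler_wpM2l //.
    by rewrite mulr_ge0 ?nrm_ge0 // ltW.
  exact: flow_bounded.
apply/ler_addgt0Pl => e e0; rewrite addr0.
pose d := Num.min (1 / 2) (e / (k + 1)).
have d0 : 0 < d by rewrite lt_min divr_gt0 // divr_gt0 // ltr_wpDl.
have d1 : d < 1 by rewrite gt_min; apply/orP; left; lra.
have d2 : d <= e / (k + 1) by rewrite ge_min lexx orbT.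
apply: (le_trans (H d d0 d1)).
move: d2; rewrite ler_pdivlMr ?ltr_wpDl // => d2; nra.
Qed.

(** If D M = B C^*, then exp(tL) kills (D z, - C^* z) for every z. *)
Let nondegenerate : (0 < n)%N ->
  D *: M <> B *m (map_mx Num.conj (map_mx Num.conj Cr)^T)^T.
Proof.
move=> n0.
have -> : (map_mx Num.conj (map_mx Num.conj Cr)^T)^T = Cr.
  by apply/matrixP => i j; rewrite !mxE conjCK.
move=> DM.
pose z : 'cV[C]_n := const_mx 1.
pose s := (Cr *m z) ord0 ord0.
have sE : Cr *m z = s%:M.
  by apply/matrixP => i j; rewrite (ord1 i) (ord1 j) [RHS]mxE eqxx mulr1n.
have DE : drsubmx (E t) = D%:M.
  by apply/matrixP => i j; rewrite (ord1 i) (ord1 j) [RHS]mxE eqxx mulr1n.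
have : E t *m col_mx (D *: z) (- s)%:M = 0.
  rewrite -(submxK (E t)) mul_block_col -/M -/B -/Cr DE -!scalemxAr scalemxAl DM.
  rewrite -mulmxA sE -mulmxDr -raddfD /= addrN raddf0 mulmx0.
  rewrite mul_scalar_mx !scale_scalar_mx -raddfD /= mulrN addrN raddf0.
  by rewrite col_mx0.
move=> /(expm_inj t0) /(congr1 (fun v : 'cV[C]_(n + 1) => v (lshift 1 (Ordinal n0)) ord0)) /eqP.
by rewrite col_mxEu !mxE mulr1 (negbTE D_neq0).
Qed.

Lemma generator_linear_fractional : (0 < n)%N -> linear_fractional (phi t).
Proof.
move=> n0; exists M, B, (map_mx Num.conj Cr)^T, D; split.
- exact: denominator_dominates.
- exact: nondegenerate.
- by move=> z zB; rewrite flowE // botE cdotE.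
Qed.

End Time.
End Linearization.

(** The displacement of a point has zero derivative; this is a linear system with
    zero coefficients. *)
Lemma zero_generator_trivial (R : realType) (n : nat)
    (phi : R -> 'cV[Cplx R]_n -> 'cV[Cplx R]_n) (G : 'cV[Cplx R]_n -> 'cV[Cplx R]_n) :
  continuous_semigroup phi -> infinitesimal_generator phi G -> (forall z, G z = 0) ->
  trivial_semigroup phi.
Proof.
move=> hphi hG G0 t z; rewrite le_eqVlt => /predU1P[<-|t0] zB.
  exact: semigroup0.
pose y i r := phi r z i ord0 - z i ord0.
have y' r i : 0 < r < t -> is_cderive r (y i) (\sum_(j < n) 0 * y j r).
  move=> /andP[r0 _]; apply: is_cderive_eq.
    apply: is_cderiveD; first exact: (generator_is_cderive hG).
    exact: (is_cderive_cst r (- z i ord0)).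
  by rewrite G0 mxE addr0 big1 // => j _; rewrite mul0r.
have yt i : y i s @[s --> t^'-] --> y i t.
  apply: cvgB; last exact: cvg_cst.
  exact: (cvg_at_left_filter (is_cderive_cvg (generator_is_cderive hG i t0 zB))).
have y0c i : y i s @[s --> 0^'+] --> y i 0.
  apply: cvgB; last exact: cvg_cst.
  by rewrite (semigroup0 hphi) //; exact: semigroup_cvg0.
have y0 i : y i 0 = 0 by rewrite /y (semigroup0 hphi) // subrr.
have Y := @linear_system_zero_forward R n y (fun _ _ _ => 0) 0 t t0 (lexx 0) y'.
apply/matrixP => i j; rewrite (ord1 j); apply/eqP; rewrite -subr_eq0; apply/eqP.
by apply: Y y0c yt y0 i => *; rewrite nrm0.
Qed.

(** * Displacement of a linear fractional map *)

Section Lipschitz.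
Variables (R : realType) (n : nat).
Local Notation C := (Cplx R).
Variables (X : 'I_n -> 'I_n -> C) (B c : 'I_n -> C) (kappa : R).
Hypotheses (X_le : forall i j, nrm (X i j) <= kappa).
Hypotheses (B_le : forall i, nrm (B i) <= kappa).
Hypotheses (c_le : forall j, nrm (c j) <= kappa).
Hypothesis kappa_small : n%:R * kappa <= 1 / 2.
Hypothesis kappa_ge0 : 0 <= kappa.
Implicit Types z w : 'cV[C]_n.

(** For the normalised map z |-> (z + X z + B) / (1 + c z), the displacement f(z) - z
    is [lf_disp] / [lf_den]. *)
Definition lf_den (c : 'I_n -> C) (z : 'cV[C]_n) : C := 1 + \sum_j c j * z j ord0.
Definition lf_disp (X : 'I_n -> 'I_n -> C) (B c : 'I_n -> C) (z : 'cV[C]_n) i : C :=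
  \sum_j X i j * z j ord0 + B i - (\sum_j c j * z j ord0) * z i ord0.

Let lin_le (e : 'I_n -> C) (z : 'I_n -> C) (d : R) : (forall j, nrm (e j) <= kappa) ->
  (forall j, nrm (z j) <= d) -> nrm (\sum_j e j * z j) <= n%:R * kappa * d.
Proof.
move=> eB zB; rewrite (le_trans (nrm_sum _)) //.
rewrite (_ : n%:R * kappa * d = \sum_(j < n) (kappa * d)); last first.
  by rewrite sumr_const card_ord -[RHS]mulr_natl mulrA.
by apply: ler_sum => j _; rewrite nrmM ler_pM ?nrm_ge0.
Qed.

Let lin_le1 (e : 'I_n -> C) z : (forall j, nrm (e j) <= kappa) ->
  (forall j, nrm (z j ord0) <= 1) -> nrm (\sum_j e j * z j ord0) <= n%:R * kappa.
Proof. by move=> eB z1; have := lin_le eB z1; rewrite mulr1. Qed.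

Let lin_led (e : 'I_n -> C) z w d : (forall j, nrm (e j) <= kappa) ->
  (forall j, nrm (z j ord0 - w j ord0) <= d) ->
  nrm (\sum_j e j * (z j ord0 - w j ord0)) <= n%:R * kappa * d.
Proof. by move=> eB zd; exact: (lin_le eB zd). Qed.

Let den_ge z : (forall j, nrm (z j ord0) <= 1) -> 1 / 2 <= nrm (lf_den c z).
Proof.
move=> z1; have H := lin_le1 c_le z1.
have : nrm 1 <= nrm (lf_den c z) + nrm (\sum_j c j * z j ord0).
  by rewrite (le_trans _ (nrmB _ _)) // /lf_den addrK.
rewrite nrm1; have := le_trans H kappa_small; lra.
Qed.

Let disp_le z i : (forall j, nrm (z j ord0) <= 1) ->
  nrm (lf_disp X B c z i) <= (2 * n%:R + 1) * kappa.
Proof.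
move=> z1; rewrite /lf_disp.
apply: (le_trans (nrmB _ _)).
have h1 := nrmD (\sum_j X i j * z j ord0) (B i).
have h2 := lin_le1 (X_le i) z1.
have h3 := lin_le1 c_le z1.
have h4 : nrm ((\sum_j c j * z j ord0) * z i ord0) <= nrm (\sum_j c j * z j ord0).
  by rewrite nrmM ler_piMr ?nrm_ge0.
have := B_le i; lra.
Qed.

Lemma lf_quotient_le z i : (forall j, nrm (z j ord0) <= 1) ->
  nrm (lf_disp X B c z i / lf_den c z) <= (4 * n%:R + 2) * kappa.
Proof.
move=> z1; rewrite nrmM nrmV ler_pdivrMr; last by have := den_ge z1; lra.
have k0 : 0 <= (2 * n%:R + 1) * kappa.
  by rewrite mulr_ge0 // addr_ge0 // mulr_ge0 // ler0n.
have := disp_le i z1; have := ler_wpM2l k0 (den_ge z1); lra.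
Qed.

(** The Lipschitz constant is linear in the size kappa of the coefficients; with
    kappa and the increment d both of the size of displacements, this is what makes
    the test displacements almost additive. *)
Lemma lf_quotient_lipschitz z w i d :
  (forall j, nrm (z j ord0) <= 1) -> (forall j, nrm (w j ord0) <= 1) ->
  (forall j, nrm (z j ord0 - w j ord0) <= d) ->
  nrm (lf_disp X B c z i / lf_den c z - lf_disp X B c w i / lf_den c w)
    <= (10 * n%:R + 2) * kappa * d.
Proof.
move=> z1 w1 zw.
have qz := den_ge z1; have qw := den_ge w1.
have qz0 : lf_den c z != 0 by rewrite -nrm_eq0; apply/eqP => E; move: qz; rewrite E; lra.
have qw0 : lf_den c w != 0 by rewrite -nrm_eq0; apply/eqP => E; move: qw; rewrite E; lra.
have d0 : 0 <= d by exact: le_trans (nrm_ge0 _) (zw i).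
have nk : 0 <= n%:R * kappa by rewrite mulr_ge0 // ler0n.
have cd := lin_led c_le zw.
have Xd := lin_led (X_le i) zw.
have cw := lin_le1 c_le w1.
have dd : nrm (lf_disp X B c z i - lf_disp X B c w i) <= 3 * (n%:R * kappa * d).
  have -> : lf_disp X B c z i - lf_disp X B c w i =
    \sum_j X i j * (z j ord0 - w j ord0)
    - ((\sum_j c j * (z j ord0 - w j ord0)) * z i ord0
       + (\sum_j c j * w j ord0) * (z i ord0 - w i ord0)).
    under [X in _ = X - _]eq_bigr do rewrite mulrBr.
    under [X in _ = _ - (X * _ + _)]eq_bigr do rewrite mulrBr.
    by rewrite !sumrB /lf_disp; ring.
  apply: (le_trans (nrmB _ _)).
  have h1 := nrmD ((\sum_j c j * (z j ord0 - w j ord0)) * z i ord0)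
    ((\sum_j c j * w j ord0) * (z i ord0 - w i ord0)).
  have h2 : nrm ((\sum_j c j * (z j ord0 - w j ord0)) * z i ord0)
      <= nrm (\sum_j c j * (z j ord0 - w j ord0)).
    by rewrite nrmM ler_piMr ?nrm_ge0.
  have h3 : nrm ((\sum_j c j * w j ord0) * (z i ord0 - w i ord0)) <= n%:R * kappa * d.
    by rewrite nrmM ler_pM ?nrm_ge0.
  lra.
have qd : nrm (lf_den c w - lf_den c z) <= n%:R * kappa * d.
  rewrite -nrmN (_ : - _ = \sum_j c j * (z j ord0 - w j ord0)) //.
  under [RHS]eq_bigr do rewrite mulrBr.
  by rewrite sumrB /lf_den; ring.
have -> : lf_disp X B c z i / lf_den c z - lf_disp X B c w i / lf_den c w =
  (lf_disp X B c z i - lf_disp X B c w i) / lf_den c z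
  + lf_disp X B c w i * (lf_den c w - lf_den c z) / (lf_den c z * lf_den c w).
  by field; rewrite qz0 qw0.
apply: (le_trans (nrmD _ _)).
have e1 : nrm ((lf_disp X B c z i - lf_disp X B c w i) / lf_den c z)
    <= 6 * (n%:R * kappa * d).
  rewrite nrmM nrmV ler_pdivrMr; last by lra.
  apply: (le_trans dd).
  have := ler_wpM2l (mulr_ge0 nk d0) qz; lra.
have e2 : nrm (lf_disp X B c w i * (lf_den c w - lf_den c z) / (lf_den c z * lf_den c w))
    <= (4 * n%:R + 2) * kappa * d.
  rewrite (_ : _ / _ = (lf_disp X B c w i / lf_den c w)
     * ((lf_den c w - lf_den c z) / lf_den c z)); last by field; rewrite qz0 qw0.
  rewrite nrmM ler_pM ?nrm_ge0 //; first exact: lf_quotient_le.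
  rewrite nrmM nrmV ler_pdivrMr; last by lra.
  apply: (le_trans qd).
  have := ler_wpM2l d0 qz; have := ler_wpM2r d0 kappa_small; lra.
lra.
Qed.

End Lipschitz.

(** Dividing by D is allowed since |D| > |C|.  As c = C^* / D has norm less than 1,
    |c z| <= (|c|^2 + |z|^2) / 2 < 1 on the ball and the denominator does not
    vanish. *)
Lemma linear_fractional_normal_form (R : realType) (n : nat)
    (f : 'cV[Cplx R]_n -> 'cV[Cplx R]_n) : linear_fractional f ->
  exists (X : 'I_n -> 'I_n -> Cplx R) (B c : 'I_n -> Cplx R),
    forall z, cball R n z -> lf_den c z != 0 /\
      forall i, f z i ord0 = z i ord0 + lf_disp X B c z i / lf_den c z.
Proof.
move=> [M [B [Cv [D [CD _ fE]]]]].
have D0 : D != 0.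
  by rewrite -normr_gt0; apply: le_lt_trans CD; rewrite enormE -rc0 rc_le sqrtr_ge0.
pose c j := (Cv j ord0)^* / D.
have c1 : \sum_j sqn (c j) < 1.
  move: CD; rewrite enorm_lt_norm => CD.
  have sD : 0 < sqn D by apply: le_lt_trans CD; exact: esq_ge0.
  rewrite (eq_bigr (fun j => sqn (Cv j ord0) / sqn D)); last first.
    move=> j _; rewrite /c !sqnE nrmM nrmV exprMn exprVn.
    by rewrite (_ : nrm _^* = nrm (Cv j ord0)) // /nrm norm_conjC.
  by rewrite -mulr_suml ltr_pdivrMr // mul1r.
exists (fun i j => M i j / D - (i == j)%:R), (fun i => B i ord0 / D), c.
move=> z zB.
have q0 : lf_den c z != 0.
  apply/eqP => q0.
  have : nrm (\sum_j c j * z j ord0) < 1.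
    move/cballE: zB => zB.
    have : \sum_j (sqn (c j) + sqn (z j ord0)) / 2 < 1.
      rewrite -mulr_suml big_split /= -/(esq z); lra.
    apply: le_lt_trans; rewrite (le_trans (nrm_sum _)) //.
    apply: ler_sum => j _; rewrite nrmM !sqnE.
    have := sqr_ge0 (nrm (c j) - nrm (z j ord0)); rewrite sqrrB; lra.
  have -> : \sum_j c j * z j ord0 = - 1.
    by apply/eqP; rewrite -addr_eq0 addrC; apply/eqP.
  by rewrite nrmN nrm1 ltxx.
split => // i.
have E : cdot z Cv + D = D * lf_den c z.
  rewrite /lf_den mulrDr mulr1 addrC; congr (_ + _).
  by rewrite mulr_sumr; apply: eq_bigr => j _; rewrite /c; field.
rewrite fE // E !mxE /lf_disp.
have -> : \sum_j (M i j / D - (i == j)%:R) * z j ord0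
    = (\sum_j M i j * z j ord0) / D - z i ord0.
  rewrite mulr_suml.
  rewrite (eq_bigr (fun j => M i j * z j ord0 / D - (i == j)%:R * z j ord0)); last first.
    by move=> j _; ring.
  rewrite sumrB; congr (_ - _).
  rewrite (bigD1 i) //= eqxx mul1r big1 ?addr0 // => j /negbTE.
  by rewrite eq_sym => ->; rewrite mul0r.
have -> : \sum_j c j * z j ord0 = lf_den c z - 1 by rewrite /lf_den addrC addKr.
by field; rewrite q0 D0.
Qed.

(** * Recovering the coefficients from displacements *)

Section TestPoints.
Variables (R : realType) (n : nat).
Local Notation C := (Cplx R).
Local Notation rp := (@complex.Re R).
Local Notation ip := (@complex.Im R).

(** The origin and half of the basis vectors with both signs. *)
Definition test_point (k : option ('I_n * bool)) : 'cV[C]_n :=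
  if k is Some (j, s) then rc (if s then 2^-1 else - 2^-1) *: delta_mx j ord0 else 0.

Lemma test_point_coord j s i :
  test_point (Some (j, s)) i ord0 = rc (if s then 2^-1 else - 2^-1) * (i == j)%:R.
Proof. by rewrite /= !mxE eqxx andbT. Qed.

Lemma test_point_ball k : cball R n (test_point k).
Proof.
case: k => [[j s]|]; last exact: cball0.
apply/cballE; rewrite /esq (bigD1 j) //= big1 => [|i ij]; last first.
  by rewrite test_point_coord (negbTE ij) mulr0 sqnE nrm0 expr0n.
rewrite test_point_coord eqxx mulr1 sqnE nrm_rc real_normK ?num_real // addr0.
by case: s; rewrite ?sqrrN; lra.
Qed.

Section Recovery.
Variables (X : 'I_n -> 'I_n -> C) (B c : 'I_n -> C).
(** F k i is the i-th coordinate of the displacement at the k-th test point. *)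
Variable F : option ('I_n * bool) -> 'I_n -> C.
Hypothesis FE : forall k i,
  F k i = lf_disp X B c (test_point k) i / lf_den c (test_point k).
Hypothesis den0 : forall k, lf_den c (test_point k) != 0.

Let sum_test (e : 'I_n -> C) j s :
  \sum_l e l * test_point (Some (j, s)) l ord0 = rc (if s then 2^-1 else - 2^-1) * e j.
Proof.
rewrite (bigD1 j) //= big1 ?addr0 => [|l lj]; rewrite test_point_coord.
  by rewrite eqxx mulr1 mulrC.
by rewrite (negbTE lj) !mulr0.
Qed.

Lemma recover_B i : B i = F None i.
Proof.
rewrite FE /lf_disp /lf_den.
rewrite big1 => [|j _]; last by rewrite mxE mulr0.
by rewrite big1 => [|j _]; rewrite ?mxE ?mulr0 // add0r subr0 addr0 divr1.
Qed.

Let F_eq j s i : let e : C := rc (if s then 2^-1 else - 2^-1) in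
  F (Some (j, s)) i * (1 + e * c j) = e * X i j + B i - e * c j * (e * (i == j)%:R).
Proof.
move=> e; rewrite FE mulrC /lf_den sum_test -/e.
have := den0 (Some (j, s)); rewrite /lf_den sum_test -/e => d0.
by rewrite mulrC divfK // /lf_disp !sum_test test_point_coord.
Qed.

Let rc_half : rc 2^-1 = 2^-1 :> C. Proof. by rewrite rcV rc_nat. Qed.

(** Adding the j-th coordinates of the identities at e_j / 2 and - e_j / 2 eliminates
    X and leaves a linear equation for c_j, whose leading coefficient is close
    to 1. *)
Lemma recover_c j : 1 + F (Some (j, true)) j - F (Some (j, false)) j != 0 ->
  c j = 2 * (2 * F None j - F (Some (j, true)) j - F (Some (j, false)) j)
      / (1 + F (Some (j, true)) j - F (Some (j, false)) j).
Proof.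
move=> d0; apply: (mulIf d0); rewrite divfK // -recover_B.
have := F_eq j true j; have := F_eq j false j => /=.
rewrite rcN rc_half eqxx !mulr1.
move: (F (Some (j, false)) j) (F (Some (j, true)) j) (B j) (c j) (X j j) => Fm Fp Bj cj Xj hm hp.
have E : Bj = (Fp * (1 + 2^-1 * cj) + Fm * (1 + - 2^-1 * cj)
    + 2^-1 * cj) / 2 by rewrite hp hm; field.
by rewrite E; field.
Qed.

Lemma recover_X i j :
  X i j = 2 * (F (Some (j, true)) i * (1 + 2^-1 * c j) - F None i)
          + 2^-1 * c j * (i == j)%:R.
Proof.
have := F_eq j true i => /=; rewrite rc_half => ->.
by rewrite -recover_B; field.
Qed.

Lemma recover_le v : 0 <= v -> v <= 1 / 8 -> (forall k i, nrm (F k i) <= v) ->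
  [/\ forall i, nrm (B i) <= 15 * v, forall j, nrm (c j) <= 15 * v &
      forall i j, nrm (X i j) <= 15 * v].
Proof.
move=> v0 v8 Fv.
have n2 : nrm (2 : C) = 2 by rewrite -rc_nat nrm_rc ger0_norm.
have nh : nrm (2^-1 : C) = 2^-1 by rewrite nrmV n2.
have cB j : nrm (c j) <= 11 * v.
  have h1 := Fv None j; have h2 := Fv (Some (j, true)) j; have h3 := Fv (Some (j, false)) j.
  have q : 3 / 4 <= nrm (1 + F (Some (j, true)) j - F (Some (j, false)) j).
    have := nrmD (1 + F (Some (j, true)) j - F (Some (j, false)) j)
       (F (Some (j, false)) j - F (Some (j, true)) j).
    have -> : 1 + F (Some (j, true)) j - F (Some (j, false)) j
      + (F (Some (j, false)) j - F (Some (j, true)) j) = 1 by ring.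
    rewrite nrm1; have := nrmB (F (Some (j, false)) j) (F (Some (j, true)) j); lra.
  have q0 : 1 + F (Some (j, true)) j - F (Some (j, false)) j != 0.
    by rewrite -nrm_eq0; apply/eqP => E; move: q; rewrite E; lra.
  rewrite recover_c // nrmM nrmV ler_pdivrMr; last by lra.
  rewrite nrmM n2.
  have g1 := nrmB (2 * F None j - F (Some (j, true)) j) (F (Some (j, false)) j).
  have g2 := nrmB (2 * F None j) (F (Some (j, true)) j).
  have g3 : nrm (2 * F None j) <= 2 * v by rewrite nrmM n2 ler_wpM2l.
  have := ler_wpM2l v0 q; lra.
split.
- by move=> i; rewrite recover_B; have := Fv None i; lra.
- by move=> j; have := cB j; lra.
move=> i j; rewrite recover_X.
have h1 := Fv None i; have h2 := Fv (Some (j, true)) i; have h3 := cB j.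
have g1 := nrmD (2 * (F (Some (j, true)) i * (1 + 2^-1 * c j) - F None i))
  (2^-1 * c j * (i == j)%:R).
have g2 : nrm (2^-1 * c j * (i == j)%:R) <= 2^-1 * (11 * v).
  rewrite !nrmM nh -[X in _ <= X]mulr1 ler_pM ?mulr_ge0 ?nrm_ge0 ?ler_wpM2l //.
  by case: eqP; rewrite ?nrm1 ?nrm0.
have g3 : nrm (1 + 2^-1 * c j) <= 2.
  have := nrmD 1 (2^-1 * c j); rewrite nrmM nh nrm1; lra.
have g4 : nrm (F (Some (j, true)) i * (1 + 2^-1 * c j)) <= v * 2.
  by rewrite nrmM ler_pM ?nrm_ge0.
have g5 := nrmB (F (Some (j, true)) i * (1 + 2^-1 * c j)) (F None i).
move: g1; rewrite nrmM n2; lra.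
Qed.

End Recovery.
End TestPoints.

Lemma choice_ex (U W : Type) (P : U -> W -> Prop) :
  (forall u, exists w, P u w) -> exists f : U -> W, forall u, P u (f u).
Proof. by move=> /choice[f Pf]; exists f. Qed.

(** * Differentiability of the coefficients at time zero *)

Section Coefficients.
Variables (R : realType) (n : nat).
Local Notation C := (Cplx R).
Local Notation rp := (@complex.Re R).
Local Notation ip := (@complex.Im R).
Variables (phi : R -> 'cV[C]_n -> 'cV[C]_n).
Hypothesis hphi : continuous_semigroup phi.
Variables (X : R -> 'I_n -> 'I_n -> C) (B c : R -> 'I_n -> C).
Hypothesis normal_form : forall t, 0 <= t -> forall z, cball R n z ->
  lf_den (c t) z != 0 /\ forall i, phi t z i ord0 =
     z i ord0 + lf_disp (X t) (B t) (c t) z i / lf_den (c t) z.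

Local Notation pt := (@test_point R n).
Variable F : R -> option ('I_n * bool) -> 'I_n -> C.
Hypothesis F_def : forall t k i, F t k i = phi t (pt k) i ord0 - pt k i ord0.

Let FE t k i : 0 <= t ->
  F t k i = lf_disp (X t) (B t) (c t) (pt k) i / lf_den (c t) (pt k).
Proof.
move=> t0; have [_ E] := normal_form t0 (test_point_ball R k).
by rewrite F_def E addrAC subrr add0r.
Qed.

(** The real and imaginary parts of all coordinates of the displacements at all
    test points. *)
Let J : finType := (option ('I_n * bool) * 'I_n * bool)%type.
Let x (k : J) t : R := if k.2 then rp (F t k.1.1 k.1.2) else ip (F t k.1.1 k.1.2).

Definition displacement t : R := \sum_k `|x k t|.
Local Notation V := displacement.

Let V_ge0 t : 0 <= V t. Proof. exact: sumr_ge0. Qed.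

Let x_le_V k t : `|x k t| <= V t.
Proof. by rewrite /V (bigD1 k) //= lerDl sumr_ge0. Qed.

Let F_le_V t k i : nrm (F t k i) <= 2 * V t.
Proof.
have := nrm_le_parts (F t k i).
have := x_le_V (k, i, true) t; have := x_le_V (k, i, false) t; rewrite /x /=; lra.
Qed.

Let F_cvg0 k i : F t k i @[t --> 0^'+] --> (0 : C).
Proof.
under eq_fun do rewrite F_def.
rewrite -(subrr (pt k i ord0)); apply: cvgB; last exact: cvg_cst.
exact: (semigroup_cvg0 hphi (test_point_ball R k)).
Qed.

Lemma displacement_cvg0 : V t @[t --> 0^'+] --> (0 : R).
Proof.
rewrite [X in _ --> X](_ : _ = \sum_(k : J) (0 : R)); last by rewrite big1.
apply: (@cvg_sumr _ _ _ _ _ _ (fun k t => `|x k t|)) => -[[k i] s].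
rewrite -[X in _ --> X](@normr0 R R); apply: cvg_norm; rewrite /x /=.
by case: s; [exact: (cvg_rp (@F_cvg0 k i)) | exact: (cvg_ip (@F_cvg0 k i))].
Qed.

Let V0 : V 0 = 0.
Proof.
rewrite /V big1 // => -[[k i] s] _; rewrite /x F_def (semigroup0 hphi) ?subrr.
  by case: s; rewrite normr0.
exact: test_point_ball.
Qed.

Let V_small e : 0 < e ->
  exists2 eta, 0 < eta & forall t, 0 <= t < eta -> V t <= e.
Proof.
move=> e0; have /cvgrPdist_lt/(_ _ e0) := displacement_cvg0.
rewrite /at_right /within /= => /nbhs_ballP[eta /= eta0 H].
exists eta => // t /andP[]; rewrite le_eqVlt => /predU1P[<- _|t0 te].
  by rewrite V0 ltW.
have := H t; rewrite /ball /= sub0r normrN (gtr0_norm t0) => /(_ te t0).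
rewrite sub0r normrN => /ltW; apply: le_trans; exact: ler_norm.
Qed.

(** The bound 1 / (60 (n + 1)) makes the test displacements at most 1/8, as needed to
    recover the coefficients, and makes n times the coefficients, which are then at
    most 30 V, at most 1/2, as needed to bound the denominators away from 0. *)
Definition small_time (delta : R) := 0 < delta /\
  forall t, 0 <= t < delta -> V t <= (60 * n.+1%:R)^-1.

Lemma small_time_exists : exists delta, small_time delta.
Proof.
have [] := @V_small (60 * n.+1%:R)^-1; first by rewrite invr_gt0 mulr_gt0.
by move=> d d0 dV; exists d; split.
Qed.

Let small_V (v : R) : 0 <= v -> v <= (60 * n.+1%:R)^-1 ->
  2 * v <= 1 / 8 /\ n%:R * (30 * v) <= 1 / 2.
Proof.
move=> v0; rewrite -[X in _ <= X]mul1r ler_pdivlMr ?mulr_gt0 // -[n.+1%:R]natr1 => H.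
have : 0 <= v * n%:R by rewrite mulr_ge0 // ler0n.
by split; lra.
Qed.

Lemma coefficients_le t delta : small_time delta -> 0 <= t < delta ->
  [/\ forall i, nrm (B t i) <= 30 * V t, forall j, nrm (c t j) <= 30 * V t &
      forall i j, nrm (X t i j) <= 30 * V t].
Proof.
move=> [_ dV] td; have [v8 _] := small_V (V_ge0 t) (dV t td).
have t0 : 0 <= t by case/andP: td.
have den0 k : lf_den (c t) (pt k) != 0.
  by have [] := normal_form t0 (test_point_ball R k).
rewrite (_ : 30 = 15 * 2 :> R) -?mulrA; last by lra.
apply: (recover_le (fun k i => FE k i t0) den0 _ v8); first by rewrite mulr_ge0.
exact: F_le_V.
Qed.

Let smallK t delta : small_time delta -> 0 <= t < delta -> n%:R * (30 * V t) <= 1 / 2.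
Proof. by move=> [_ dV] td; have [] := small_V (V_ge0 t) (dV t td). Qed.

Lemma flow_displacement_le t delta z i : small_time delta -> 0 <= t < delta ->
  cball R n z -> nrm (phi t z i ord0 - z i ord0) <= (4 * n%:R + 2) * (30 * V t).
Proof.
move=> hd td zB; have t0 : 0 <= t by case/andP: td.
have [_ ->] := normal_form t0 zB; rewrite addrAC subrr add0r.
have [Bl cl Xl] := coefficients_le hd td.
apply: lf_quotient_le => //; rewrite ?mulr_ge0 //; first exact: smallK td.
by move=> j; exact: cball_coord.
Qed.

(** By the semigroup law, the defect of additivity is the difference of the
    displacements of phi_t at phi_s(p) and at p. *)
Let x_add delta : small_time delta -> forall k s t, 0 <= s -> 0 <= t -> s + t < delta ->
  `|x k (s + t) - x k s - x k t| <= (60 * (10 * n%:R + 2)) * V s * V t.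
Proof.
move=> hd k s t s0 t0 std.
have td : 0 <= t < delta by apply/andP; split => //; lra.
have [Bl cl Xl] := coefficients_le hd td.
suff H p i : nrm (F (s + t) p i - F s p i - F t p i)
    <= (60 * (10 * n%:R + 2)) * V s * V t.
  case: k => [[p i] b]; rewrite /x /=; case: b.
    by rewrite -!rpB (le_trans (rp_le_nrm _)).
  by rewrite -!ipB (le_trans (ip_le_nrm _)).
have pB := test_point_ball R p.
have sB : cball R n (phi s (pt p)) by exact: (semigroup_selfmap hphi).
have -> : F (s + t) p i - F s p i - F t p i =
    (phi t (phi s (pt p)) i ord0 - phi s (pt p) i ord0) - (phi t (pt p) i ord0 - pt p i ord0).
  by rewrite !F_def [s + t]addrC (semigroupD hphi) //; ring.
have [_ ->] := normal_form t0 sB; have [_ ->] := normal_form t0 pB.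
rewrite ![_ + _ / _]addrC !addrK.
rewrite (_ : _ * V t = (10 * n%:R + 2) * (30 * V t) * (2 * V s)); last by ring.
apply: lf_quotient_lipschitz => //; rewrite ?mulr_ge0 //; first exact: smallK td.
- by move=> j; exact: cball_coord.
- by move=> j; exact: cball_coord.
- by move=> j; rewrite -F_def; exact: F_le_V.
Qed.

Lemma test_displacement_derivable k i :
  exists l : C, (rc t)^-1 * F t k i @[t --> 0^'+] --> l.
Proof.
have [delta hd] := small_time_exists.
have K0 : 0 <= 60 * (10 * n%:R + 2) :> R.
  by rewrite mulr_ge0 // addr_ge0 // mulr_ge0 // ler0n.
have D := almost_additive_derivable (proj1 hd) K0 (x_add hd) V_small.
have [lr Hr] := D (k, i, true); have [li Hi] := D (k, i, false).
exists (Complex lr li); apply: cvg_parts => /=.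
  rewrite (_ : (fun t => _) = fun t => x (k, i, true) t / t) //.
  by apply/funext => t; rewrite -rcV rp_rcM mulrC.
rewrite (_ : (fun t => _) = fun t => x (k, i, false) t / t) //.
by apply/funext => t; rewrite -rcV ip_rcM mulrC.
Qed.

Let near_small delta : small_time delta -> \forall t \near (0 : R)^'+, 0 <= t < delta.
Proof.
move=> [d0 _]; near=> t; apply/andP; split; first by apply: ltW; near: t; exact: nbhs_right_gt.
by near: t; exact: nbhs_right_lt.
Unshelve. all: by end_near. Qed.

Let V30_cvg0 (k : R) : k * V t @[t --> 0^'+] --> (0 : R).
Proof.
rewrite -[X in _ --> X](mulr0 k).
by apply: cvgM; [exact: cvg_cst | exact: displacement_cvg0].
Qed.

Lemma c_cvg0 i : c t i @[t --> 0^'+] --> (0 : C).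
Proof.
have [delta hd] := small_time_exists.
apply: cvg_nrm0 (V30_cvg0 30); apply: filterS (near_small hd) => t td.
by rewrite subr0; have [] := coefficients_le hd td.
Qed.

Lemma B_derivable : exists a : 'I_n -> C, forall i, (rc t)^-1 * B t i @[t --> 0^'+] --> a i.
Proof.
apply: (@choice_ex _ _ (fun i (l : C) => (rc t)^-1 * B t i @[t --> 0^'+] --> l)) => i.
have [l Hl] := test_displacement_derivable None i; exists l.
apply: cvg_trans; last exact: Hl.
apply: near_eq_cvg; near=> t.
have t0 : 0 <= t by apply: ltW; near: t; exact: nbhs_right_gt.
by rewrite (recover_B (fun k i => FE k i t0)).
Unshelve. all: by end_near. Qed.

Let cvg_cstC (a : C) : a @[t --> (0 : R)^'+] --> a. Proof. exact: cvg_cst. Qed.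
(** Limit rules at 0 from the right, with the filter fixed so that they compose as
    terms. *)
Let rlimD (f g : R -> C) (a b : C) : f t @[t --> 0^'+] --> a ->
  g t @[t --> 0^'+] --> b -> f t + g t @[t --> 0^'+] --> a + b.
Proof. exact: ccvgD. Qed.
Let rlimB (f g : R -> C) (a b : C) : f t @[t --> 0^'+] --> a ->
  g t @[t --> 0^'+] --> b -> f t - g t @[t --> 0^'+] --> a - b.
Proof. exact: ccvgB. Qed.
Let rlimM (f g : R -> C) (a b : C) : f t @[t --> 0^'+] --> a ->
  g t @[t --> 0^'+] --> b -> f t * g t @[t --> 0^'+] --> a * b.
Proof. exact: ccvgM. Qed.
Let rlimV (f : R -> C) (a : C) : a != 0 -> f t @[t --> 0^'+] --> a ->
  (f t)^-1 @[t --> 0^'+] --> a^-1.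
Proof. exact: ccvgV. Qed.

Lemma c_derivable : exists gam : 'I_n -> C, forall j, (rc t)^-1 * c t j @[t --> 0^'+] --> gam j.
Proof.
apply: (@choice_ex _ _ (fun j (l : C) => (rc t)^-1 * c t j @[t --> 0^'+] --> l)) => j.
have [l0 H0] := test_displacement_derivable None j.
have [lp Hp] := test_displacement_derivable (Some (j, true)) j.
have [lm Hm] := test_displacement_derivable (Some (j, false)) j.
have q0 : 1 + 0 - 0 != 0 :> C by rewrite addr0 subr0 oner_neq0.
have Q : (1 + F t (Some (j, true)) j - F t (Some (j, false)) j)^-1 @[t --> 0^'+]
    --> ((1 + 0 - 0)^-1 : C) := rlimV q0 (rlimB (rlimD (@cvg_cstC 1) (@F_cvg0 (Some (j, true)) j))
  (@F_cvg0 (Some (j, false)) j)).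
exists (2 * (2 * l0 - lp - lm) * (1 + 0 - 0)^-1).
have N := rlimM (@cvg_cstC 2) (rlimB (rlimB (rlimM (@cvg_cstC 2) H0) Hp) Hm).
have H := rlimM N Q.
apply: cvg_trans; last exact: H.
apply: near_eq_cvg.
have [delta hd] := small_time_exists.
apply: filterS (near_small hd) => t td.
have t0 : 0 <= t by case/andP: td.
have [v8 _] := small_V (V_ge0 t) (proj2 hd t td).
have den0 k : lf_den (c t) (pt k) != 0.
  by have [] := normal_form t0 (test_point_ball R k).
rewrite (recover_c (fun k i => FE k i t0) den0) //; first by ring.
apply/eqP => E.
have : nrm (1 : C) <= 4 * V t.
  have -> : 1 = F t (Some (j, false)) j - F t (Some (j, true)) j.
    by apply/eqP; rewrite -subr_eq0 -[X in _ == X]E; apply/eqP; ring.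
  have := nrmB (F t (Some (j, false)) j) (F t (Some (j, true)) j).
  have := F_le_V t (Some (j, false)) j; have := F_le_V t (Some (j, true)) j; lra.
rewrite nrm1; lra.
Qed.

Lemma X_derivable : exists X' : 'I_n -> 'I_n -> C,
  forall i j, (rc t)^-1 * X t i j @[t --> 0^'+] --> X' i j.
Proof.
have [gam Hg] := c_derivable.
have [a Ha] := B_derivable.
suff H i : exists f : 'I_n -> C, forall j, (rc t)^-1 * X t i j @[t --> 0^'+] --> f j.
  exact: (@choice_ex _ _ (fun i (f : 'I_n -> C) =>
    forall j, (rc t)^-1 * X t i j @[t --> 0^'+] --> f j) H).
apply: (@choice_ex _ _ (fun j (l : C) => (rc t)^-1 * X t i j @[t --> 0^'+] --> l)) => j.
have [l0 H0] := test_displacement_derivable None i.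
have [lp Hp] := test_displacement_derivable (Some (j, true)) i.
exists (2 * (lp * (1 + 2^-1 * 0) - l0) + 2^-1 * gam j * (i == j)%:R).
have H := rlimD (rlimM (@cvg_cstC 2) (rlimB (rlimM Hp
    (rlimD (@cvg_cstC 1) (rlimM (@cvg_cstC 2^-1) (@c_cvg0 j)))) H0))
    (rlimM (rlimM (@cvg_cstC 2^-1) (Hg j)) (@cvg_cstC (i == j)%:R)).
apply: cvg_trans; last exact: H.
apply: near_eq_cvg.
near=> t.
have t0 : 0 <= t by apply: ltW; near: t; exact: nbhs_right_gt.
have den0 k : lf_den (c t) (pt k) != 0.
  by have [] := normal_form t0 (test_point_ball R k).
by rewrite (recover_X (fun k i => FE k i t0) den0) //; ring.
Unshelve. all: by end_near. Qed.

End Coefficients.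

(** The function rho bounds the displacements uniformly on the ball; it gives the
    left continuity of the orbits at positive times. *)
Lemma coefficients_derivable (R : realType) (n : nat)
    (phi : R -> 'cV[Cplx R]_n -> 'cV[Cplx R]_n)
    (X : R -> 'I_n -> 'I_n -> Cplx R) (B c : R -> 'I_n -> Cplx R) :
  continuous_semigroup phi ->
  (forall t, 0 <= t -> forall z, cball R n z ->
    lf_den (c t) z != 0 /\ forall i, phi t z i ord0 =
      z i ord0 + lf_disp (X t) (B t) (c t) z i / lf_den (c t) z) ->
  exists (X' : 'I_n -> 'I_n -> Cplx R) (B' c' : 'I_n -> Cplx R) (rho : R -> R),
    [/\ [/\ forall i j, (rc t)^-1 * X t i j @[t --> 0^'+] --> X' i j,
          forall i, (rc t)^-1 * B t i @[t --> 0^'+] --> B' i &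
          forall j, (rc t)^-1 * c t j @[t --> 0^'+] --> c' j],
      forall j, c t j @[t --> 0^'+] --> (0 : Cplx R),
      rho t @[t --> 0^'+] --> (0 : R) &
      \forall t \near 0^'+, forall z i, cball R n z ->
        nrm (phi t z i ord0 - z i ord0) <= rho t].
Proof.
move=> hphi nf.
pose F t k i := phi t (@test_point R n k) i ord0 - @test_point R n k i ord0.
have FE t k i : F t k i = phi t (@test_point R n k) i ord0 - @test_point R n k i ord0.
  by [].
have [X' HX] := X_derivable hphi nf FE.
have [B' HB] := B_derivable hphi nf FE.
have [c' Hc] := c_derivable hphi nf FE.
have [delta hd] := small_time_exists hphi FE.
exists X', B', c', (fun t => ((4 * n%:R + 2) * 30) * displacement F t).
split; [by split | exact: (c_cvg0 hphi nf FE) | |].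
  rewrite -[X in _ --> X](mulr0 ((4 * n%:R + 2) * 30)).
  by apply: cvgM; [exact: cvg_cst | exact: (displacement_cvg0 hphi FE)].
near=> t => z i zB; rewrite -[_ * 30 * _]mulrA.
apply: (flow_displacement_le nf FE i hd _ zB).
apply/andP; split; first by apply: ltW; near: t; exact: nbhs_right_gt.
by near: t; apply: nbhs_right_lt; case: hd.
Unshelve. all: by end_near. Qed.

(** * The generator of a semigroup of linear fractional maps *)

Section GeneratorFromCoefficients.
Variables (R : realType) (n : nat).
Local Notation C := (Cplx R).
Variables (phi : R -> 'cV[C]_n -> 'cV[C]_n).
Variables (X : R -> 'I_n -> 'I_n -> C) (B c : R -> 'I_n -> C).
Hypothesis normal_form : forall t, 0 <= t -> forall z, cball R n z ->
  lf_den (c t) z != 0 /\ forall i, phi t z i ord0 =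
     z i ord0 + lf_disp (X t) (B t) (c t) z i / lf_den (c t) z.
Variables (X' : 'I_n -> 'I_n -> C) (B' c' : 'I_n -> C).
Hypothesis X_der : forall i j, (rc t)^-1 * X t i j @[t --> 0^'+] --> X' i j.
Hypothesis B_der : forall i, (rc t)^-1 * B t i @[t --> 0^'+] --> B' i.
Hypothesis c_der : forall j, (rc t)^-1 * c t j @[t --> 0^'+] --> c' j.
Hypothesis c_to0 : forall j, c t j @[t --> 0^'+] --> (0 : C).

Section AlongFilter.
Context {T : Type} {FT : set_system T} {FF : Filter FT}.
Let lS (f : 'I_n -> T -> C) (a : 'I_n -> C) : (forall i, f i t @[t --> FT] --> a i) ->
  \sum_i f i t @[t --> FT] --> \sum_i a i.
Proof. exact: cvg_sumr. Qed.

(** The base point w and the time k both vary along the filter: for the derivative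
    from the left at time t, the base point is phi_(t - k)(z). *)
Lemma difference_quotient_cvg (k : T -> R) (w : T -> 'cV[C]_n) (z : 'cV[C]_n) i :
  k t @[t --> FT] --> 0^'+ ->
  (\forall t \near FT, cball R n (w t)) ->
  (forall j, w t j ord0 @[t --> FT] --> z j ord0) ->
  (rc (k t))^-1 * (phi (k t) (w t) i ord0 - w t i ord0) @[t --> FT]
    --> lf_disp X' B' c' z i.
Proof.
move=> k0 wB wz.
have kpos : \forall t \near FT, 0 < k t.
  exact: (k0 [set s | 0 < s] (nbhs_right_gt 0)).
have Xk a b : (rc (k t))^-1 * X (k t) a b @[t --> FT] --> X' a b.
  exact: (cvg_comp _ _ k0 (@X_der a b)).
have Bk a : (rc (k t))^-1 * B (k t) a @[t --> FT] --> B' a.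
  exact: (cvg_comp _ _ k0 (@B_der a)).
have ck a : (rc (k t))^-1 * c (k t) a @[t --> FT] --> c' a.
  exact: (cvg_comp _ _ k0 (@c_der a)).
have c0 a : c (k t) a @[t --> FT] --> (0 : C).
  exact: (cvg_comp _ _ k0 (@c_to0 a)).
have D : 1 + \sum_j c (k t) j * w t j ord0 @[t --> FT] --> 1 + \sum_j 0 * z j ord0.
  apply: ccvgD; first exact: cvg_cst.
  by apply: (@lS (fun j t => c (k t) j * w t j ord0)) => j; exact: (ccvgM (c0 j) (wz j)).
have d0 : 1 + \sum_j 0 * z j ord0 != 0.
  by rewrite big1 ?addr0 ?oner_neq0 // => j _; rewrite mul0r.
have N1 : \sum_j ((rc (k t))^-1 * X (k t) i j) * w t j ord0 @[t --> FT]
    --> \sum_j X' i j * z j ord0.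
  by apply: (@lS (fun j t => ((rc (k t))^-1 * X (k t) i j) * w t j ord0)) => j;
    exact: (ccvgM (Xk i j) (wz j)).
have N2 : \sum_j ((rc (k t))^-1 * c (k t) j) * w t j ord0 @[t --> FT]
    --> \sum_j c' j * z j ord0.
  by apply: (@lS (fun j t => ((rc (k t))^-1 * c (k t) j) * w t j ord0)) => j;
    exact: (ccvgM (ck j) (wz j)).
have H := ccvgM (ccvgB (ccvgD N1 (@Bk i)) (ccvgM N2 (wz i))) (ccvgV d0 D).
rewrite (_ : lf_disp X' B' c' z i = (\sum_j X' i j * z j ord0 + B' i
   - (\sum_j c' j * z j ord0) * z i ord0) / (1 + \sum_j 0 * z j ord0)); last first.
  by rewrite [X in _ / (_ + X)]big1 ?addr0 ?divr1 // => j _; rewrite mul0r.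
apply: cvg_trans; last exact: H.
apply: near_eq_cvg.
near=> t.
have kt : 0 <= k t.
  by apply: ltW; near: t; exact: kpos.
have wt : cball R n (w t) by near: t.
have [_ ->] := normal_form kt wt.
rewrite [w t i ord0 + _]addrC addrK /lf_disp /lf_den.
under eq_bigr do rewrite -mulrA.
rewrite -mulr_sumr.
under [X in _ - X * _]eq_bigr do rewrite -mulrA.
rewrite -mulr_sumr.
ring.
Unshelve. all: by end_near. Qed.

End AlongFilter.
End GeneratorFromCoefficients.

Lemma cvg_col (R : realType) (n : nat) (T : Type) (FT : set_system T) (FF : Filter FT)
    (f : T -> 'cV[Cplx R]_n) (l : 'cV[Cplx R]_n) :
  (forall i, f t i ord0 @[t --> FT] --> l i ord0) -> f t @[t --> FT] --> l.
Proof.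
move=> fl; apply/cvg_ballP => e e0.
have H i : \forall t \near FT, ball (l i ord0) e (f t i ord0).
  by move/cvg_ballP : (@fl i); apply.
have := filter_forall FF H; apply: filterS => t Ht; split=> // i j.
by rewrite (ord1 j).
Qed.

(** Each coordinate is a polynomial in the coordinates of z. *)
Lemma differentiable_quadratic (R : realType) (n : nat) (a b : 'cV[Cplx R]_n)
    (A : 'M[Cplx R]_n) (z : 'cV[Cplx R]_n) :
  differentiable (fun z => a - cdot z a *: z - (A *m z + cdot z b *: z)) z.
Proof.
have dc i : differentiable (fun z : 'cV[Cplx R]_n => z i ord0) z.
  exact: differentiable_coord.
have dl (e : 'I_n -> Cplx R) :
    differentiable (fun z : 'cV[Cplx R]_n => \sum_j e j * z j ord0) z.
  rewrite (_ : (fun z => _) =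
     \sum_(j < n) (fun z : 'cV[Cplx R]_n => e j * z j ord0)); last first.
    by apply/funext => w; rewrite fct_sumE.
  apply: differentiable_sum => j.
  have D := (@differentiableM _ _ (cst (e j)) (fun w : 'cV[Cplx R]_n => w j ord0) z
    (differentiable_cst _ _) (dc j)).
  exact: D.
pose g i (z : 'cV[Cplx R]_n) := a i ord0 - (\sum_j (a j ord0)^* * z j ord0) * z i ord0
  - (\sum_j A i j * z j ord0 + (\sum_j (b j ord0)^* * z j ord0) * z i ord0).
rewrite (_ : (fun z => _) =
    \sum_(i < n) (fun z => g i z *: (delta_mx i ord0 : 'cV[Cplx R]_n))); last first.
  apply/funext => w; rewrite fct_sumE; apply/matrixP => i j; rewrite (ord1 j).
  rewrite summxE (bigD1 i) //= big1 => [|k /negbTE ki]; last first.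
    by rewrite !mxE eq_sym ki mulr0.
  rewrite addr0 [RHS]mxE [X in _ = _ * X]mxE !eqxx mulr1 /g !mxE /cdot.
  by congr (_ - _ * _ - (_ + _ * _)); apply: eq_bigr => k _; rewrite mulrC.
apply: differentiable_sum => i; apply: differentiableZl.
have dq (e : 'I_n -> Cplx R) : differentiable
    (fun w : 'cV[Cplx R]_n => (\sum_j e j * w j ord0) * w i ord0) z.
  exact: (differentiableM (dl e) (dc i)).
exact: (differentiableB
  (differentiableB (differentiable_cst (a i ord0) z) (dq _))
  (differentiableD (dl _) (dq _))).
Qed.

(** Continuity at 1 of a quadratic polynomial; it takes an inequality on the open
    ball to the sphere along a radius. *)
Lemma quadratic_le0_at1 (R : realType) (p q s : R) :
  (forall r, 0 <= r < 1 -> p * r ^+ 2 + q * r + s <= 0) -> p + q + s <= 0.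
Proof.
move=> H; rewrite leNgt; apply/negP => S0.
pose M := `|2 * p + q| + `|p| + 1.
have M0 : 0 < M by rewrite ltr_pwDr // addr_ge0.
pose e := Num.min 1 ((p + q + s) / (2 * M)).
have e0 : 0 < e by rewrite lt_min ltr01 divr_gt0 // mulr_gt0.
have e1 : e <= 1 by rewrite ge_min lexx.
have e2 : e * M <= (p + q + s) / 2.
  have : e <= (p + q + s) / (2 * M) by rewrite ge_min lexx orbT.
  rewrite ler_pdivlMr ?mulr_gt0 //; lra.
have /H : 0 <= 1 - e < 1 by apply/andP; split; lra.
rewrite (_ : p * _ + _ + _ = (p + q + s) - e * (2 * p + q) + e * (e * p)); last by ring.
have h1 := ler_wpM2l (ltW e0) (ler_norm (2 * p + q)).
have h2 : - `|p| <= e * p.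
  have := ler_norm (- p); rewrite normrN => h.
  have := normr_ge0 p; nra.
have h3 := ler_wpM2l (ltW e0) h2.
rewrite /M !mulrDr in e2; lra.
Qed.

Section Generator.
Variables (R : realType) (n : nat).
Local Notation C := (Cplx R).
Local Notation rp := (@complex.Re R).
Local Notation ip := (@complex.Im R).
Variables (phi : R -> 'cV[C]_n -> 'cV[C]_n).
Hypothesis hphi : continuous_semigroup phi.
Variables (X : R -> 'I_n -> 'I_n -> C) (B c : R -> 'I_n -> C).
Hypothesis normal_form : forall t, 0 <= t -> forall z, cball R n z ->
  lf_den (c t) z != 0 /\ forall i, phi t z i ord0 =
     z i ord0 + lf_disp (X t) (B t) (c t) z i / lf_den (c t) z.
Variables (X' : 'I_n -> 'I_n -> C) (B' c' : 'I_n -> C) (rho : R -> R).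
Hypothesis X_der : forall i j, (rc t)^-1 * X t i j @[t --> 0^'+] --> X' i j.
Hypothesis B_der : forall i, (rc t)^-1 * B t i @[t --> 0^'+] --> B' i.
Hypothesis c_der : forall j, (rc t)^-1 * c t j @[t --> 0^'+] --> c' j.
Hypothesis c_to0 : forall j, c t j @[t --> 0^'+] --> (0 : C).
Hypothesis rho_to0 : rho t @[t --> 0^'+] --> (0 : R).
Hypothesis rho_bound : \forall t \near 0^'+, forall z i, cball R n z ->
  nrm (phi t z i ord0 - z i ord0) <= rho t.

(** For h > 0 the quotient is the displacement of phi_h at phi_t(z) divided by h; for
    h < 0 it is the displacement of phi_|h| at phi_(t - |h|)(z) divided by |h|. *)
Lemma flow_derivative t z i : 0 <= t -> cball R n z ->
  (rc h)^-1 * (phi (t + h) z i ord0 - phi t z i ord0)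
    @[h --> within [set h : R | 0 <= t + h] 0^'] --> lf_disp X' B' c' (phi t z) i.
Proof.
move=> t0 zB.
pose FT := within [set h : R | 0 <= t + h] 0^'.
pose w h := if 0 < h then phi t z else phi (t + h) z.
have tB : cball R n (phi t z) by exact: (semigroup_selfmap hphi).
have hne : \forall h \near FT, h != 0.
  exact: (cvg_within _ (@nbhs_dnbhs_neq _ 0)).
have hdom : \forall h \near FT, 0 <= t + h by exact: withinT.
have k0 : `|h| @[h --> FT] --> (0 : R)^'+.
  move=> P; rewrite /at_right /within /= => /nbhs_ballP[e /= e0 eP].
  have : \forall h \near FT, `|h| < e.
    exact: (cvg_within _ (dnbhs0_lt e0)).
  rewrite /nbhs /= => he; near=> h; apply: eP.
    by rewrite /ball /= sub0r normrN normr_id; near: h.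
  by rewrite normr_gt0; near: h.
have wB : \forall h \near FT, cball R n (w h).
  near=> h; rewrite /w; case: ifP => // _.
  by apply: (semigroup_selfmap hphi) => //; near: h.
have flow_back h : h < 0 -> 0 <= t + h -> phi t z = phi `|h| (phi (t + h) z).
  move=> h0 th; rewrite -(semigroupD hphi) // ltr0_norm //.
  by congr phi; ring.
have wz j : w h j ord0 @[h --> FT] --> phi t z j ord0.
  have rk : rho `|h| @[h --> FT] --> (0 : R) by exact: (cvg_comp _ _ k0 rho_to0).
  apply: cvg_nrm0 rk.
  have rb := k0 _ rho_bound.
  near=> h.
  have hb : forall z i, cball R n z -> nrm (phi `|h| z i ord0 - z i ord0) <= rho `|h|.
    by near: h; exact: rb.
  have h0 : h != 0 by near: h.
  have th : 0 <= t + h by near: h.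
  have whB : cball R n (w h) by near: h.
  move: whB; rewrite /w; have [hp _|hn whB] := ltP 0 h.
    by rewrite subrr nrm0; apply: (le_trans (nrm_ge0 _) (hb _ j tB)).
  have {}hn : h < 0 by rewrite lt_neqAle h0.
  by rewrite (flow_back h hn th) -nrmN opprB; exact: hb.
have H := difference_quotient_cvg normal_form X_der B_der c_der c_to0 (i := i) k0 wB wz.
apply: cvg_trans; last exact: H.
apply: near_eq_cvg; near=> h.
have h0 : h != 0 by near: h.
have th : 0 <= t + h by near: h.
rewrite /w; have [hp|hn] := ltP 0 h.
  rewrite gtr0_norm // -(semigroupD hphi) ?(ltW hp) //.
  by rewrite [h + t]addrC.
have {}hn : h < 0 by rewrite lt_neqAle h0.
rewrite -(flow_back h hn th) ltr0_norm // rcN invrN; ring.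
Unshelve. all: by end_near. Qed.

(** The linear fractional map phi_t sends the closed ball into itself, that is
    |u + v| <= |1 + c u| with v = X u + B.  For |u| = 1 this reads
    2 Re <v,u> + |v|^2 <= 2 Re(c u) + |c u|^2, where the quadratic term on the right
    is o(t). *)
Lemma boundary_inequality u : esq u = 1 ->
  \sum_i rp ((\sum_j X' i j * u j ord0 + B' i) * (u i ord0)^*)
    <= rp (\sum_j c' j * u j ord0).
Proof.
move=> u1.
pose v t i := \sum_j X t i j * u j ord0 + B t i.
pose cu t := \sum_j c t j * u j ord0.
(* The inequality at r u, for r < 1, is quadratic in r. *)
have S t : 0 <= t -> \sum_i sqn (u i ord0 + v t i) <= sqn (1 + cu t).
  move=> t0.
  pose m i := u i ord0 + \sum_j X t i j * u j ord0.
  pose dot (x y : C) := rp x * rp y + ip x * ip y.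
  have sqn_lin r (x y : C) : sqn (rc r * x + y) = sqn x * r ^+ 2 + 2 * dot x y * r + sqn y.
    by rewrite /sqn /dot rpD ipD rp_rcM ip_rcM; ring.
  have sqn1 : sqn (1 : C) = 1 by rewrite sqnE nrm1 expr1n.
  have Q r : 0 <= r < 1 -> \sum_i sqn (rc r * m i + B t i) <= sqn (rc r * cu t + 1).
    move=> /andP[r0 r1]; pose z := rc r *: u.
    have zB : cball R n z.
      by apply/cballE; rewrite esqZ u1 mulr1 sqnE nrm_rc ger0_norm // expr_lt1.
    have [q0 E] := normal_form t0 zB.
    have cz : lf_den (c t) z = rc r * cu t + 1.
      rewrite /lf_den addrC /cu mulr_sumr; congr (_ + _).
      by apply: eq_bigr => j _; rewrite mxE; ring.
    have fB : cball R n (phi t z) by exact: (semigroup_selfmap hphi).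
    move/cballE: fB => fB; rewrite -cz.
    have -> : \sum_i sqn (rc r * m i + B t i) = esq (phi t z) * sqn (lf_den (c t) z).
      rewrite /esq mulr_suml; apply: eq_bigr => i _; rewrite -sqnM E mulrDl divfK //.
      congr sqn; rewrite /lf_den /lf_disp /m.
      have -> : \sum_j X t i j * z j ord0 = rc r * \sum_j X t i j * u j ord0.
        by rewrite mulr_sumr; apply: eq_bigr => j _; rewrite mxE; ring.
      have -> : z i ord0 = rc r * u i ord0 by rewrite mxE.
      by ring.
    by rewrite ler_piMl ?sqn_ge0 // ltW.
  have := @quadratic_le0_at1 R (\sum_i sqn (m i) - sqn (cu t))
    (\sum_i 2 * dot (m i) (B t i) - 2 * dot (cu t) 1) (\sum_i sqn (B t i) - 1).
  have E1 r : \sum_i sqn (rc r * m i + B t i) =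
      (\sum_i sqn (m i)) * r ^+ 2 + (\sum_i 2 * dot (m i) (B t i)) * r + \sum_i sqn (B t i).
    by rewrite !mulr_suml -!big_split; apply: eq_bigr => i _; exact: sqn_lin.
  have E2 : \sum_i sqn (u i ord0 + v t i) = \sum_i sqn (rc 1 * m i + B t i).
    by apply: eq_bigr => i _; rewrite /v /m rc1 mul1r addrA.
  have E3 : sqn (1 + cu t) = sqn (rc 1 * cu t + 1) by rewrite rc1 mul1r addrC.
  move=> /(_ _) H; rewrite E2 E3 E1 sqn_lin sqn1.
  have {}H : \sum_i sqn (m i) - sqn (cu t) + (\sum_i 2 * dot (m i) (B t i) - 2 * dot (cu t) 1)
     + (\sum_i sqn (B t i) - 1) <= 0.
    apply: H => r /Q; rewrite E1 sqn_lin sqn1; lra.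
  lra.
have S2 t : 0 <= t ->
    2 * \sum_i rp (v t i * (u i ord0)^*) <= 2 * rp (cu t) + rp (cu t * (cu t)^*).
  move=> /S.
  have -> : sqn (1 + cu t) = 1 + 2 * rp (cu t) + rp (cu t * (cu t)^*).
    by rewrite mul_conj_sqn rp_rc /sqn rpD ipD rp1 ip1; ring.
  have -> : \sum_i sqn (u i ord0 + v t i) =
     esq u + 2 * (\sum_i rp (v t i * (u i ord0)^*)) + \sum_i sqn (v t i).
    rewrite /esq mulr_sumr -!big_split; apply: eq_bigr => i _ /=.
    by rewrite rpM rp_conj ip_conj /sqn rpD ipD; ring.
  rewrite u1; have : 0 <= \sum_i sqn (v t i) by apply: sumr_ge0 => i _; exact: sqn_ge0.
  lra.
pose V t i := \sum_j ((rc t)^-1 * X t i j) * u j ord0 + (rc t)^-1 * B t i.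
pose CU t := \sum_j ((rc t)^-1 * c t j) * u j ord0.
have VE t i : V t i = (rc t)^-1 * v t i.
  rewrite /V /v mulrDr mulr_sumr; congr (_ + _).
  by apply: eq_bigr => j _; rewrite mulrA.
have CUE t : CU t = (rc t)^-1 * cu t.
  by rewrite /CU /cu mulr_sumr; apply: eq_bigr => j _; rewrite mulrA.
have S3 t : 0 < t -> 2 * \sum_i rp (V t i * (u i ord0)^*)
    <= 2 * rp (CU t) + rp (CU t * (cu t)^*).
  move=> t0; rewrite -(ler_pM2l t0).
  have -> : t * (2 * \sum_i rp (V t i * (u i ord0)^*)) = 2 * \sum_i rp (v t i * (u i ord0)^*).
    rewrite mulrCA mulr_sumr; congr (_ * _); apply: eq_bigr => i _.
    by rewrite VE -mulrA -rcV rp_rcM mulrA mulfV ?mul1r // gt_eqF.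
  have -> : t * (2 * rp (CU t) + rp (CU t * (cu t)^*)) = 2 * rp (cu t) + rp (cu t * (cu t)^*).
    rewrite CUE -mulrA -rcV !rp_rcM; field; lra.
  exact/S2/ltW.
have cstu j : u j ord0 @[t --> (0 : R)^'+] --> u j ord0 by exact: cvg_cst.
have cstuc j : (u j ord0)^* @[t --> (0 : R)^'+] --> (u j ord0)^* by exact: cvg_cst.
have VL i : V t i @[t --> 0^'+] --> \sum_j X' i j * u j ord0 + B' i.
  have VL1 : \sum_j ((rc t)^-1 * X t i j) * u j ord0 @[t --> 0^'+]
      --> \sum_j X' i j * u j ord0.
    apply: (@cvg_sumr _ _ _ _ _ _ (fun j t => ((rc t)^-1 * X t i j) * u j ord0)) => j.
    exact: (ccvgM (@X_der i j) (@cstu j)).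
  exact: (ccvgD VL1 (@B_der i)).
have CUL : CU t @[t --> 0^'+] --> \sum_j c' j * u j ord0.
  apply: (@cvg_sumr _ _ _ _ _ _ (fun j t => ((rc t)^-1 * c t j) * u j ord0)) => j.
  exact: (ccvgM (@c_der j) (@cstu j)).
have cuL : cu t @[t --> 0^'+] --> \sum_j 0 * u j ord0.
  apply: (@cvg_sumr _ _ _ _ _ _ (fun j t => c t j * u j ord0)) => j.
  exact: (ccvgM (@c_to0 j) (@cstu j)).
have s0 : \sum_j 0 * u j ord0 = 0 by rewrite big1 // => j _; rewrite mul0r.
rewrite s0 in cuL.
have L1 : \sum_i rp (V t i * (u i ord0)^*) @[t --> 0^'+]
    --> \sum_i rp ((\sum_j X' i j * u j ord0 + B' i) * (u i ord0)^*).
  apply: (@cvg_sumr _ _ _ _ _ _ (fun i t => rp (V t i * (u i ord0)^*))) => i.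
  exact: (cvg_rp (ccvgM (@VL i) (@cstuc i))).
have L2 : rp (CU t * (cu t)^*) @[t --> 0^'+] --> (0 : R).
  rewrite (_ : (fun t => _) = fun t => rp (CU t) * rp (cu t) + ip (CU t) * ip (cu t)); last first.
    by apply/funext => t; rewrite rpM rp_conj ip_conj; ring.
  rewrite [X in _ --> X](_ : _ = rp (\sum_j c' j * u j ord0) * 0
     + ip (\sum_j c' j * u j ord0) * 0); last by rewrite !mulr0 addr0.
  apply: cvgD; apply: cvgM.
  - exact: (cvg_rp CUL).
  - exact: (cvg_rp cuL).
  - exact: (cvg_ip CUL).
  - exact: (cvg_ip cuL).
have L3 := cvg_rp CUL.
have La : 2 * \sum_i rp (V t i * (u i ord0)^*) @[t --> 0^'+]
    --> 2 * \sum_i rp ((\sum_j X' i j * u j ord0 + B' i) * (u i ord0)^*).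
  by apply: cvgM; [exact: cvg_cst | exact: L1].
have Lb : 2 * rp (CU t) + rp (CU t * (cu t)^*) @[t --> 0^'+]
    --> 2 * rp (\sum_j c' j * u j ord0) + 0.
  by apply: cvgD; [apply: cvgM; [exact: cvg_cst | exact: L3] | exact: L2].
suff : 2 * \sum_i rp ((\sum_j X' i j * u j ord0 + B' i) * (u i ord0)^*)
    <= 2 * rp (\sum_j c' j * u j ord0) + 0 by rewrite addr0 ler_pM2l.
apply: (ler_cvg_to La Lb); near=> t; apply: S3; near: t; exact: nbhs_right_gt.
Unshelve. all: by end_near. Qed.

End Generator.

(** * The inequality on the sphere and the characterization *)

Section HermitianForm.
Variables (R : realType) (n : nat).
Local Notation C := (Cplx R).
Implicit Types (u v w : 'cV[C]_n) (x : C).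

Lemma cdotZl x u v : cdot (x *: u) v = x * cdot u v.
Proof. by rewrite /cdot mulr_sumr; apply: eq_bigr => j _; rewrite mxE mulrA. Qed.

Lemma cdotZr x u v : cdot u (x *: v) = x^* * cdot u v.
Proof.
by rewrite /cdot mulr_sumr; apply: eq_bigr => j _; rewrite mxE rmorphM mulrCA.
Qed.

Lemma cdotDr u v w : cdot u (v + w) = cdot u v + cdot u w.
Proof.
by rewrite /cdot -big_split; apply: eq_bigr => j _; rewrite mxE rmorphD mulrDr.
Qed.

Lemma cdot_conj u v : cdot v u = (cdot u v)^*.
Proof.
rewrite /cdot rmorph_sum; apply: eq_bigr => j _.
by rewrite rmorphM /= conjCK mulrC.
Qed.

End HermitianForm.

(** Among the unimodular multiples x u of u, choose the one for which <x u, b> is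
    - |<u, b>|; <A u, u> does not change. *)
Lemma inequality_by_rotation (R : realType) (n : nat) (b : 'cV[Cplx R]_n)
    (A : 'M[Cplx R]_n) :
  (forall u, esq u = 1 -> - complex.Re (cdot (A *m u) u) <= complex.Re (cdot u b)) ->
  forall u, esq u = 1 -> nrm (cdot b u) <= complex.Re (cdot (A *m u) u).
Proof.
move=> H u u1.
have -> : nrm (cdot b u) = nrm (cdot u b).
  by rewrite (cdot_conj u b) /nrm norm_conjC.
have [b0|b0] := eqVneq (cdot u b) 0.
  by have := H u u1; rewrite b0 nrm0 rp0; lra.
have s0 : nrm (cdot u b) != 0 by rewrite nrm_eq0.
pose x : Cplx R := - (cdot u b)^* / rc (nrm (cdot u b)).
have x1 : sqn x = 1.
  rewrite sqnE /x nrmM nrmN nrmV nrm_rc (ger0_norm (nrm_ge0 _)).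
  have -> : nrm (cdot u b)^* = nrm (cdot u b) by rewrite /nrm norm_conjC.
  by rewrite divff // expr1n.
have := H (x *: u); rewrite esqZ x1 mul1r => /(_ u1).
rewrite -scalemxAr !cdotZl cdotZr mulrA mul_conj_sqn x1 rc1 mul1r.
have -> : x * cdot u b = - rc (nrm (cdot u b)).
  have E : (cdot u b)^* * cdot u b = rc (nrm (cdot u b)) * rc (nrm (cdot u b)).
    by rewrite mulrC mul_conj_sqn sqnE expr2 rcM.
  rewrite /x mulrAC mulNr E mulNr mulfK //.
  by rewrite rc_eq0.
rewrite rpN rp_rc; lra.
Qed.

(** The coefficients of the generator are a = B', A = - X', and b is determined by
    <z, a + b> = c' z. *)
Lemma linear_fractional_generator (R : realType) (n : nat)
    (phi : R -> 'cV[Cplx R]_n -> 'cV[Cplx R]_n) :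
  continuous_semigroup phi -> (forall t, 0 <= t -> linear_fractional (phi t)) ->
  exists (a b : 'cV[Cplx R]_n) (A : 'M[Cplx R]_n),
    infinitesimal_generator phi
      (fun z => a - cdot z a *: z - (A *m z + cdot z b *: z)) /\
    (forall u, esq u = 1 -> - complex.Re (cdot (A *m u) u) <= complex.Re (cdot u b)).
Proof.
move=> hphi hLF.
have [q Hq] : exists q : R -> ('I_n -> 'I_n -> Cplx R) * ('I_n -> Cplx R) * ('I_n -> Cplx R),
    forall t, 0 <= t -> forall z, cball R n z ->
    lf_den (q t).2 z != 0 /\ forall i, phi t z i ord0 =
     z i ord0 + lf_disp (q t).1.1 (q t).1.2 (q t).2 z i / lf_den (q t).2 z.
  apply: (@choice_ex _ _ (fun t q => 0 <= t -> forall z, cball R n z ->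
    lf_den q.2 z != 0 /\ forall i, phi t z i ord0 =
     z i ord0 + lf_disp q.1.1 q.1.2 q.2 z i / lf_den q.2 z)) => t.
  have [t0|t0] := leP 0 t; last by exists (fun _ _ => 0, fun=> 0, fun=> 0).
  by have [X [B [c H]]] := linear_fractional_normal_form (hLF t t0); exists (X, B, c).
have [X' [B' [c' [rho [[X_der B_der c_der] c0 rho0 rhob]]]]] :=
  coefficients_derivable hphi Hq.
pose a : 'cV[Cplx R]_n := \col_i B' i.
pose b : 'cV[Cplx R]_n := \col_i ((c' i)^* - B' i).
pose A : 'M[Cplx R]_n := \matrix_(i, j) (- X' i j).
have ab (z : 'cV[Cplx R]_n) : \sum_j c' j * z j ord0 = cdot z a + cdot z b.
  rewrite -cdotDr; apply: eq_bigr => j _.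
  by rewrite !mxE addrC subrK conjCK mulrC.
have AE (z : 'cV[Cplx R]_n) i : (A *m z) i ord0 = - \sum_j X' i j * z j ord0.
  by rewrite mxE -sumrN; apply: eq_bigr => j _; rewrite mxE mulNr.
have GE (z : 'cV[Cplx R]_n) i :
  (a - cdot z a *: z - (A *m z + cdot z b *: z)) i ord0 = lf_disp X' B' c' z i.
  rewrite /lf_disp ab.
  move: (AE z i); move: (A *m z) => w wE.
  rewrite !mxE wE; ring.
exists a, b, A; split; first split.
- by move=> z _; exact: differentiable_quadratic.
- move=> t z t0 zB; apply: cvg_col => i.
  have := flow_derivative hphi Hq X_der B_der c_der c0 rho0 rhob (i := i) t0 zB.
  rewrite GE (_ : (fun h => _) = (fun h : R =>
    (((h%:C)%C : Cplx R)^-1 *: (phi (t + h) z - phi t z)) i ord0)) //.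
  by apply/funext => h; rewrite !mxE.
move=> u u1.
have := boundary_inequality hphi Hq X_der B_der c_der c0 u1.
rewrite ab rpD.
rewrite (_ : \sum_i _ = - complex.Re (cdot (A *m u) u) + complex.Re (cdot a u)).
  by rewrite (cdot_conj u a) rp_conj; lra.
rewrite -rpN -rpD /cdot -sumrN -big_split /= rp_sum; apply: eq_bigr => i _.
by rewrite AE [a i ord0]mxE; congr complex.Re; ring.
Qed.

(* The identity semigroup is linear fractional and has generator 0, which is of
   the stated form only for a = b = A = 0; hence the guard on "not all zero". *)
Theorem theorem0p2 (R : realType) (n : nat) (hn : (1 <= n)%N)
    (phi : R -> 'cV[Cplx R]_n -> 'cV[Cplx R]_n)
    (hphi : continuous_semigroup phi) :
  (forall t : R, 0 <= t -> linear_fractional_selfmap (phi t)) <->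
  (exists (a b : 'cV[Cplx R]_n) (A : 'M[Cplx R]_n),
    [/\ ~ trivial_semigroup phi -> ~ [/\ a = 0, b = 0 & A = 0],
        infinitesimal_generator phi
          (fun z => a - cdot z a *: z - (A *m z + cdot z b *: z)) &
        forall u, csphere R n u -> `|cdot b u| <= 'Re (cdot (A *m u) u)]).
Proof.
split=> [hLF|[a [b [A [_ hG _]]]] t t0]; last first.
  split; first exact: (generator_linear_fractional hphi hG).
  exact: (semigroup_selfmap hphi).
have [a [b [A [hG hA]]]] := linear_fractional_generator hphi (fun t t0 => proj1 (hLF t t0)).
exists a, b, A; split => //.
- move=> nt [a0 b0 A0]; apply: nt; apply: (zero_generator_trivial hphi hG) => z.
  have c0 : cdot z 0 = 0.
    by rewrite /cdot big1 // => j _; rewrite mxE rmorph0 mulr0.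
  by rewrite a0 b0 A0 mul0mx c0 scale0r !subr0 addr0 // subrr.
- move=> u /csphereE u1; rewrite nrmE Re_rp rc_le.
  exact: inequality_by_rotation.
Qed.
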